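(* Let $R:(-1,1)\to(0,\infty)$ be a smooth metric of non-negative Gaussian curvature in $(-1,1)$. If $f$ is a real $R$-harmonic function of the unit disk $\mathbb{D}$ into $(-1,1)$, then for all $z,w\in\mathbb{D}$ $$|\nabla f(z)|\le\frac{4}{\pi}\,\frac{1-f(z)^2}{1-|z|^2}$$ and $$d_h(f(z),f(w))\le\frac{4}{\pi}\,d_h(z,w),$$ and both inequalities are sharp, i.e. in neither of them can the constant $4/\pi$ be replaced by a smaller constant valid for all such $R$ and $f$.
   Context: $\mathbb{D}=\{z\in\mathbb{C}:|z|<1\}$. A smooth positive function $R$ on $(-1,1)$ is viewed as the conformal metric density $\rho(u,v)=R(u)$ on the strip $(-1,1)\times\mathbb{R}$, whose Gaussian curvature is $\mathcal{K}_\rho(u,v)=-\frac{1}{R(u)^2}\left(\frac{R'(u)}{R(u)}\right)'$; ''$R$ has non-negative Gaussian curvature'' means $\mathcal{K}_\rho\ge0$. A real-valued $\mathcal{C}^2$ function $f:\mathbb{D}\to(-1,1)$ is called (real) $R$-harmonic if $$\Delta f+\frac{R'(f)}{R(f)}|\nabla f|^2=0\quad\text{on }\mathbb{D},$$ where $\Delta$ and $\nabla$ are the Euclidean Laplacian and gradient. The hyperbolic distance on $\mathbb{D}$ is $d_h(z,w)=\tanh^{-1}\frac{|z-w|}{|1-z\bar w|}$, applied also to real points of $(-1,1)\subset\mathbb{D}$. *)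

(* Defs.v *)
From Stdlib Require Import Reals.
From Coquelicot Require Import Coquelicot.
Open Scope R_scope.

Definition unit_disk (z : C) : Prop := Cmod z < 1.

(** Functions on an open set are represented by total functions; all the
    notions below at a point of the disk or of (-1,1) are local, so the values
    outside are irrelevant. *)

Definition dx (f : C -> R) (z : C) : R := Derive (fun x => f (x, Im z)) (Re z).
Definition dy (f : C -> R) (z : C) : R := Derive (fun y => f (Re z, y)) (Im z).

Definition C1_on (D : C -> Prop) (f : C -> R) : Prop :=
  forall z : C, D z ->
    ex_derive (fun x => f (x, Im z)) (Re z) /\
    ex_derive (fun y => f (Re z, y)) (Im z) /\
    continuous (dx f) z /\ continuous (dy f) z.

Definition C2_on (D : C -> Prop) (f : C -> R) : Prop :=
  C1_on D f /\ C1_on D (dx f) /\ C1_on D (dy f).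

Definition grad_norm (f : C -> R) (z : C) : R := sqrt (dx f z ^ 2 + dy f z ^ 2).
Definition laplacian (f : C -> R) (z : C) : R := dx (dx f) z + dy (dy f) z.

Definition smooth_metric (Rm : R -> R) : Prop :=
  forall u : R, -1 < u < 1 -> 0 < Rm u /\ forall n : nat, ex_derive_n Rm n u.

(** Curvature at (u,v) of the conformal density (u,v) |-> Rm u on the strip
    (-1,1) x R; it does not depend on v. *)
Definition gaussian_curvature (Rm : R -> R) (u : R) : R :=
  - (1 / Rm u ^ 2) * Derive (fun t => Derive Rm t / Rm t) u.

Definition nonneg_curvature (Rm : R -> R) : Prop :=
  forall u : R, -1 < u < 1 -> 0 <= gaussian_curvature Rm u.

Definition R_harmonic (Rm : R -> R) (f : C -> R) : Prop :=
  (forall z : C, unit_disk z -> -1 < f z < 1) /\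
  C2_on unit_disk f /\
  (forall z : C, unit_disk z ->
     laplacian f z + Derive Rm (f z) / Rm (f z) * grad_norm f z ^ 2 = 0).

Definition artanh (x : R) : R := / 2 * ln ((1 + x) / (1 - x)).

Definition hyp_dist (z w : C) : R :=
  artanh (Cmod (z - w)%C / Cmod (1 - z * Cconj w)%C).

(* Main.v *)
Require Import Defs.
From Stdlib Require Import Reals Lra Psatz.
From Coquelicot Require Import Coquelicot.
Open Scope R_scope.

(** Let [F] be a primitive of the metric [Rm].  The equation of [R]-harmonicity
    says exactly that [u = F o f] is an ordinary harmonic function, and
    non-negative curvature says that [ln Rm] is concave.  Both inequalities come
    from a sharp Schwarz lemma for [u], transported back through the concavity.

    Schwarz lemma ([grad_bound]).  Let [u : D -> [-1,1]] be harmonic.  The mean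
    value property and the cosine moment on the circle of radius [r] give
    [2 PI u(0) = int u] and [PI r u_x(0) = int u cos].  For a fixed mean value
    the cosine moment is largest when [u] jumps from [-1] to [1] on an arc
    [|th| < al] ([bang_bang]), whence [u_x(0) <= 4/PI cos(PI u(0)/2)], and the
    right-hand side is at most [4/PI (1 - u(0)^2)].  Composing with a disk
    automorphism moves the origin to any point and turns the gradient into the
    direction of the real axis.

    Transport ([majorant_harmonic_mean]).  Fix [t = f z] and [k = Rm'(t)/Rm(t)].
    The tangent line of the concave function [ln Rm] gives
    [Rm(s) <= E(s) := Rm(t) exp(k (s - t))], so that [u] takes its values in
    [[F(t) - A, F(t) + B]], where [A] and [B] are the integrals of [E] over
    [[-1,t]] and [[t,1]].  The Schwarz lemma for this interval
    ([grad_bound_interval]) bounds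
    [Rm(t) |grad f(z)| (1 - |z|^2)] by [4/PI * 2 A B / (A + B)].  The trapezoid
    rule overestimates integrals of the convex function [E]; together with
    [k A = E(t) - E(-1)] and [k B = E(1) - E(t)] this yields
    [2 A B / (A + B) <= Rm(t) (1 - t^2)], which is the gradient inequality.

    Integrating the gradient inequality along the hyperbolic geodesic from [z]
    to [w] gives the distance inequality ([distance_of_grad_bound]).  Equality
    in the infinitesimal estimate is attained at the origin by
    [Im (2/PI log ((1+z)/(1-z)))] for the constant metric, and this single
    function proves that both constants are sharp.

    Differentiability in the plane is expressed throughout by derivatives along
    curves, so that the chain rule for compositions holds by definition and all
    computations are with functions of one real variable. *)

(** * Differentiation along curves in the disk *)

Definition curve_deriv (c : R -> C) (t : R) (d : C) : Prop :=
  is_derive (fun s => Re (c s)) t (Re d) /\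
  is_derive (fun s => Im (c s)) t (Im d).

(** The complex number [a z] encodes the gradient as [u_x - i u_y], so that the
    directional derivative in the direction [d] is the real part of [a z * d].
    For harmonic [u] this [a] is holomorphic. *)
Definition has_grad (u : C -> R) (a : C -> C) : Prop :=
  forall (c : R -> C) (t : R) (d : C),
    curve_deriv c t d -> unit_disk (c t) ->
    is_derive (fun s => u (c s)) t (Re (a (c t) * d)%C).

(** Holomorphy in the form used for integrals over circles: the derivative [h']
    is part of the data and has to be continuous. *)
Definition holo (h h' : C -> C) : Prop :=
  (forall (c : R -> C) (t : R) (d : C),
     curve_deriv c t d -> unit_disk (c t) ->
     curve_deriv (fun s => h (c s)) t (h' (c t) * d)%C) /\
  (forall z, unit_disk z -> continuous h z /\ continuous h' z).

Lemma is_derive_eq (f : R -> R) (t l l' : R) :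
  is_derive f t l -> l = l' -> is_derive f t l'.
Proof. now intros H <-. Qed.

Lemma C_eq (z w : C) : Re z = Re w -> Im z = Im w -> z = w.
Proof. destruct z, w; simpl; congruence. Qed.

Lemma unit_disk_sqr (z : C) : unit_disk z <-> Re z ^ 2 + Im z ^ 2 < 1.
Proof.
unfold unit_disk, Cmod; fold (Re z) (Im z); split; intros H.
- replace (Re z ^ 2 + Im z ^ 2) with (sqrt (Re z ^ 2 + Im z ^ 2) ^ 2).
  + pose proof (sqrt_pos (Re z ^ 2 + Im z ^ 2)); nra.
  + apply pow2_sqrt; nra.
- rewrite <- sqrt_1; apply sqrt_lt_1_alt; split; [nra | exact H].
Qed.

Lemma Cmod_sqr (z : C) : Cmod z ^ 2 = Re z ^ 2 + Im z ^ 2.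
Proof. unfold Cmod; apply pow2_sqrt; fold (Re z) (Im z); nra. Qed.

Lemma continuous_Rplus {T : UniformSpace} (f g : T -> R) (z : T) :
  continuous f z -> continuous g z -> continuous (fun x => f x + g x) z.
Proof. exact (@continuous_plus T R_AbsRing R_NormedModule f g z). Qed.

Lemma continuous_Rminus {T : UniformSpace} (f g : T -> R) (z : T) :
  continuous f z -> continuous g z -> continuous (fun x => f x - g x) z.
Proof. exact (@continuous_minus T R_AbsRing R_NormedModule f g z). Qed.

Lemma continuous_Ropp {T : UniformSpace} (f : T -> R) (z : T) :
  continuous f z -> continuous (fun x => - f x) z.
Proof. exact (@continuous_opp T R_AbsRing R_NormedModule f z). Qed.

Lemma continuous_Rmult {T : UniformSpace} (f g : T -> R) (z : T) :
  continuous f z -> continuous g z -> continuous (fun x => f x * g x) z.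
Proof. exact (@continuous_mult T R_AbsRing f g z). Qed.

Section Continuity.
Context {T : UniformSpace}.

Lemma continuous_Re (h : T -> C) (z : T) :
  continuous h z -> continuous (fun x => Re (h x)) z.
Proof.
intros H; apply (continuous_comp h (fun p : C => fst p)); [exact H|].
destruct (h z); apply continuous_fst.
Qed.

Lemma continuous_Im (h : T -> C) (z : T) :
  continuous h z -> continuous (fun x => Im (h x)) z.
Proof.
intros H; apply (continuous_comp h (fun p : C => snd p)); [exact H|].
destruct (h z); apply continuous_snd.
Qed.

Lemma continuous_ReIm (h : T -> C) (z : T) :
  continuous (fun x => Re (h x)) z -> continuous (fun x => Im (h x)) z ->
  continuous h z.
Proof.
intros H1 H2.
apply (continuous_ext (fun x => (Re (h x), Im (h x)))).
{ intros x; now destruct (h x). }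
apply (continuous_comp_2 (fun x => Re (h x)) (fun x => Im (h x)) (fun x y => (x, y)));
  try assumption.
apply (continuous_ext (fun p => p)); [now intros []|].
apply continuous_id.
Qed.

Lemma continuous_Cmult (h k : T -> C) (z : T) :
  continuous h z -> continuous k z -> continuous (fun x => h x * k x)%C z.
Proof.
intros Hh Hk.
pose proof (continuous_Re h z Hh) as H1; pose proof (continuous_Im h z Hh) as H2.
pose proof (continuous_Re k z Hk) as H3; pose proof (continuous_Im k z Hk) as H4.
apply continuous_ReIm; simpl.
- apply (continuous_Rminus (fun x => Re (h x) * Re (k x)) (fun x => Im (h x) * Im (k x)));
  now apply continuous_Rmult.
- apply (continuous_Rplus (fun x => Re (h x) * Im (k x)) (fun x => Im (h x) * Re (k x)));
  now apply continuous_Rmult.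
Qed.

Lemma continuous_Cplus (h k : T -> C) (z : T) :
  continuous h z -> continuous k z -> continuous (fun x => h x + k x)%C z.
Proof.
intros Hh Hk.
pose proof (continuous_Re h z Hh) as H1; pose proof (continuous_Im h z Hh) as H2.
pose proof (continuous_Re k z Hk) as H3; pose proof (continuous_Im k z Hk) as H4.
apply continuous_ReIm; simpl.
- now apply (continuous_Rplus (fun x => Re (h x)) (fun x => Re (k x))).
- now apply (continuous_Rplus (fun x => Im (h x)) (fun x => Im (k x))).
Qed.

Lemma continuous_Rinv_fun (g : T -> R) (z : T) :
  continuous g z -> g z <> 0 -> continuous (fun x => / g x) z.
Proof.
intros H H0; apply (continuous_comp g Rinv); [exact H|].
apply continuity_pt_filterlim, continuity_pt_inv; [|exact H0].
apply continuity_pt_id.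
Qed.

Lemma continuous_Cinv (h : T -> C) (z : T) :
  continuous h z -> h z <> 0%C -> continuous (fun x => / h x)%C z.
Proof.
intros Hh H0.
pose proof (continuous_Re h z Hh) as H1; pose proof (continuous_Im h z Hh) as H2.
assert (Hs : continuous (fun x => fst (h x) ^ 2 + snd (h x) ^ 2) z).
{ apply continuous_Rplus; apply continuous_Rmult; try assumption;
  apply continuous_Rmult; try assumption; apply continuous_const. }
assert (Hn : fst (h z) ^ 2 + snd (h z) ^ 2 <> 0).
{ intros E; apply H0, C_eq; simpl; unfold Re, Im; nra. }
apply continuous_ReIm; simpl; unfold Rdiv; apply continuous_Rmult.
- exact H1.
- now apply continuous_Rinv_fun.
- now apply (continuous_Ropp (fun x => Im (h x))).
- now apply continuous_Rinv_fun.
Qed.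
End Continuity.

Lemma holo_continuous (h h' : C -> C) z : holo h h' -> unit_disk z -> continuous h z.
Proof. intros [_ H] Hz; exact (proj1 (H z Hz)). Qed.

Lemma holo_deriv_continuous (h h' : C -> C) z : holo h h' -> unit_disk z -> continuous h' z.
Proof. intros [_ H] Hz; exact (proj2 (H z Hz)). Qed.

Lemma holo_ext (h h1 h2 : C -> C) :
  (forall z, unit_disk z -> h1 z = h2 z) -> holo h h1 ->
  (forall z, unit_disk z -> continuous h2 z) -> holo h h2.
Proof.
intros E [H1 H2] H3; split.
- intros c t d Hc Hd; rewrite <- E by exact Hd; auto.
- intros z Hz; exact (conj (proj1 (H2 z Hz)) (H3 z Hz)).
Qed.

Lemma holo_const (k : C) : holo (fun _ => k) (fun _ => 0%C).
Proof.
split; [|intros; split; apply continuous_const].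
intros c t d _ _; split; simpl.
- apply (is_derive_eq _ _ 0); [exact (is_derive_const (Re k) t) | ring].
- apply (is_derive_eq _ _ 0); [exact (is_derive_const (Im k) t) | ring].
Qed.

Lemma holo_id : holo (fun z => z) (fun _ => 1%C).
Proof.
split; [|intros; split; [apply continuous_id|apply continuous_const]].
intros c t d [H1 H2] _; split; simpl.
- apply (is_derive_eq _ _ _ _ H1); unfold Re, Im; ring.
- apply (is_derive_eq _ _ _ _ H2); unfold Re, Im; ring.
Qed.

Lemma holo_plus (h h' k k' : C -> C) : holo h h' -> holo k k' ->
  holo (fun z => h z + k z)%C (fun z => h' z + k' z)%C.
Proof.
intros [H1 H2] [K1 K2]; split.
- intros c t d Hc Hd; destruct (H1 c t d Hc Hd) as [A B], (K1 c t d Hc Hd) as [A' B'].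
  split; simpl.
  + eapply is_derive_eq; [exact (is_derive_plus _ _ _ _ _ A A')|].
    unfold plus; simpl; unfold Re, Im; ring.
  + eapply is_derive_eq; [exact (is_derive_plus _ _ _ _ _ B B')|].
    unfold plus; simpl; unfold Re, Im; ring.
- intros z Hz; destruct (H2 z Hz), (K2 z Hz); split; now apply continuous_Cplus.
Qed.

Lemma holo_mult (h h' k k' : C -> C) : holo h h' -> holo k k' ->
  holo (fun z => h z * k z)%C (fun z => h' z * k z + h z * k' z)%C.
Proof.
intros [H1 H2] [K1 K2]; split.
- intros c t d Hc Hd; destruct (H1 c t d Hc Hd) as [A B], (K1 c t d Hc Hd) as [A' B'].
  split; simpl.
  + eapply is_derive_eq; [exact (is_derive_minus _ _ _ _ _ (Derive.is_derive_mult _ _ _ _ _ A A') (Derive.is_derive_mult _ _ _ _ _ B B'))|].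
    unfold minus, plus, opp; simpl; unfold Re, Im; ring.
  + eapply is_derive_eq; [exact (is_derive_plus _ _ _ _ _ (Derive.is_derive_mult _ _ _ _ _ A B') (Derive.is_derive_mult _ _ _ _ _ B A'))|].
    unfold plus; simpl; unfold Re, Im; ring.
- intros z Hz; destruct (H2 z Hz), (K2 z Hz); split;
  [|apply continuous_Cplus]; now apply continuous_Cmult.
Qed.

Lemma holo_inv (h h' : C -> C) : holo h h' ->
  (forall z, unit_disk z -> h z <> 0%C) ->
  holo (fun z => / h z)%C (fun z => - h' z * (/ h z * / h z))%C.
Proof.
intros [H1 H2] Hn; split.
- intros c t d Hc Hd; destruct (H1 c t d Hc Hd) as [A B].
  assert (N : fst (h (c t)) ^ 2 + snd (h (c t)) ^ 2 <> 0).
  { intros E; apply (Hn _ Hd), C_eq; simpl; unfold Re, Im; nra. }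
  assert (S : is_derive (fun s => fst (h (c s)) ^ 2 + snd (h (c s)) ^ 2) t
    (2 * Re (h (c t)) * Re (h' (c t) * d)%C + 2 * Im (h (c t)) * Im (h' (c t) * d)%C)).
  { eapply is_derive_eq; [exact (is_derive_plus _ _ _ _ _ (is_derive_pow _ 2 _ _ A) (is_derive_pow _ 2 _ _ B))|].
    unfold plus; simpl; unfold Re, Im; ring. }
  split; simpl.
  + eapply is_derive_eq; [exact (is_derive_div _ _ _ _ _ A S N)|].
    simpl in *; unfold Re, Im in *; field; intros E; apply N; rewrite <- E; ring.
  + eapply is_derive_eq; [exact (is_derive_div _ _ _ _ _ (is_derive_opp _ _ _ B) S N)|].
    unfold opp; simpl in *; unfold Re, Im in *; field; intros E; apply N; rewrite <- E; ring.
- intros z Hz; destruct (H2 z Hz); split; [now apply continuous_Cinv; auto|].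
  apply continuous_Cmult.
  + apply (continuous_ext (fun x => (-1)%R * h' x)%C); [intros x; apply C_eq; simpl; unfold Re, Im; ring|].
    apply continuous_Cmult; [apply continuous_const|assumption].
  + apply continuous_Cmult; now apply continuous_Cinv; auto.
Qed.

Lemma holo_comp (h h' p p' : C -> C) : holo h h' -> holo p p' ->
  (forall z, unit_disk z -> unit_disk (p z)) ->
  holo (fun z => h (p z)) (fun z => h' (p z) * p' z)%C.
Proof.
intros [H1 H2] [P1 P2] HD; split.
- intros c t d Hc Hd; rewrite <- Cmult_assoc.
  apply (H1 (fun s => p (c s))); auto.
- intros z Hz; destruct (P2 z Hz), (H2 (p z) (HD z Hz)); split.
  + now apply (continuous_comp p h).
  + apply continuous_Cmult; [now apply (continuous_comp p h') | assumption].
Qed.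

Lemma has_grad_comp (u : C -> R) (a p p' : C -> C) : has_grad u a -> holo p p' ->
  (forall z, unit_disk z -> unit_disk (p z)) ->
  has_grad (fun z => u (p z)) (fun z => a (p z) * p' z)%C.
Proof.
intros Hu [P1 P2] HD c t d Hc Hd; rewrite <- Cmult_assoc.
apply (Hu (fun s => p (c s))); auto.
Qed.

Lemma holo_Re (h h' : C -> C) : holo h h' -> has_grad (fun z => Re (h z)) h'.
Proof. intros [H _] c t d Hc Hd; apply (H c t d Hc Hd). Qed.

(** * Mean values over circles *)

Definition circ (r th : R) : C := (r * cos th, r * sin th).

Lemma circ_in_disk r th : Rabs r < 1 -> unit_disk (circ r th).
Proof.
intros H; apply unit_disk_sqr; simpl.
pose proof (sin2_cos2 th) as S; unfold Rsqr in S.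
apply Rabs_def2 in H.
replace (_ + _) with (r * r * (sin th * sin th + cos th * cos th)) by ring.
rewrite S; nra.
Qed.

Lemma circ_deriv_r r th : curve_deriv (fun s => circ s th) r (circ 1 th).
Proof.
split; simpl; auto_derive; auto.
Qed.

Lemma circ_deriv_th r th : curve_deriv (fun s => circ r s) th (Ci * circ r th)%C.
Proof.
split; simpl; auto_derive; auto; ring.
Qed.

Lemma circ_continuous (x : R * R) :
  continuous (fun p : R * R => circ (fst p) (snd p)) x.
Proof.
destruct x as [r th].
assert (C1 : continuous (fun p : R * R => cos (snd p)) (r, th)).
{ apply (continuous_comp snd cos); [apply continuous_snd | apply continuous_cos]. }
assert (C2 : continuous (fun p : R * R => sin (snd p)) (r, th)).
{ apply (continuous_comp snd sin); [apply continuous_snd | apply continuous_sin]. }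
apply continuous_ReIm; simpl; apply continuous_Rmult;
 try assumption; apply continuous_fst.
Qed.

Lemma circ_continuous_th (r th : R) : continuous (circ r) th.
Proof.
apply continuous_ReIm; simpl; apply continuous_Rmult.
- apply continuous_const.
- apply continuous_cos.
- apply continuous_const.
- apply continuous_sin.
Qed.

Lemma is_derive_continuous (f : R -> R) t l : is_derive f t l -> continuous f t.
Proof. intros H; apply (ex_derive_continuous f); now exists l. Qed.

Lemma has_grad_circ_continuous (u : C -> R) a r th : has_grad u a -> Rabs r < 1 ->
  continuous (fun s => u (circ r s)) th.
Proof.
intros Hu Hr; eapply is_derive_continuous.
apply (Hu (fun s => circ r s) th _ (circ_deriv_th r th)); now apply circ_in_disk.
Qed.

Lemma locally_Rabs_lt_1 r : Rabs r < 1 -> locally r (fun s => Rabs s < 1).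
Proof.
intros H. assert (P : 0 < 1 - Rabs r) by lra.
exists (mkposreal _ P); intros s Hs.
change (Rabs (s - r) < 1 - Rabs r) in Hs.
replace s with ((s - r) + r) by ring.
pose proof (Rabs_triang (s - r) r); lra.
Qed.

(** Differentiation under the integral sign.  The radius is allowed to be
    negative, so that [r = 0] is an interior point of the parameter range. *)
Lemma deriv_circle_mean (u : C -> R) (a : C -> C) (w : R -> R) (r : R) :
  has_grad u a -> (forall z, unit_disk z -> continuous a z) ->
  (forall th, continuous w th) -> Rabs r < 1 ->
  is_derive (fun s => RInt (fun th => u (circ s th) * w th) (- PI) PI) r
    (RInt (fun th => Re (a (circ r th) * circ 1 th)%C * w th) (- PI) PI).
Proof.
intros Hu Ha Hw Hr.
assert (D : forall s th, Rabs s < 1 ->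
  is_derive (fun x => u (circ x th) * w th) s (Re (a (circ s th) * circ 1 th)%C * w th)).
{ intros s th Hs.
  eapply is_derive_eq; [apply Derive.is_derive_mult; [|apply is_derive_const]|].
  - apply (Hu (fun x => circ x th) s _ (circ_deriv_r s th)); now apply circ_in_disk.
  - unfold zero; simpl; ring. }
eapply is_derive_eq; [apply is_derive_RInt_param|].
- apply filter_imp with (2 := locally_Rabs_lt_1 r Hr).
  intros s Hs th _; eexists; now apply D.
- intros th _.
  apply (continuity_2d_pt_ext_loc (fun s t => Re (a (circ s t) * circ 1 t)%C * w t)).
  { apply locally_2d_locally.
    apply filter_imp with (fun p : R * R => Rabs (fst p) < 1).
    - intros p Hp; symmetry; now apply is_derive_unique, D.
    - exact (continuous_fst r th _ (locally_Rabs_lt_1 r Hr)). }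
  assert (K : continuous (fun p : R * R => Re (a (circ (fst p) (snd p)) * circ 1 (snd p))%C * w (snd p)) (r, th)).
  { apply continuous_Rmult.
    - apply continuous_Re, continuous_Cmult.
      + apply (continuous_comp (fun p : R * R => circ (fst p) (snd p)) a);
          [apply circ_continuous | now apply Ha, circ_in_disk].
      + apply (continuous_comp snd (circ 1)); [apply continuous_snd | apply circ_continuous_th].
    - apply (continuous_comp snd w); [apply continuous_snd | apply Hw]. }
  apply continuity_2d_pt_filterlim; exact K.
- apply filter_imp with (2 := locally_Rabs_lt_1 r Hr).
  intros s Hs; apply (@ex_RInt_continuous R_CompleteNormedModule); intros th _.
  apply continuous_Rmult; [eapply has_grad_circ_continuous; eauto | apply Hw].
- apply RInt_ext; intros th _; now apply is_derive_unique, D.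
Qed.

(** Only the derivative on the open interval [(0,1)] is asked to vanish: the
    circle means below have derivatives that are computed after division by the
    radius. *)
Lemma zero_deriv_const (f f' : R -> R) (r : R) :
  (forall s, Rabs s < 1 -> is_derive f s (f' s)) ->
  (forall s, 0 < s < 1 -> f' s = 0) -> 0 <= r < 1 -> f r = f 0.
Proof.
intros Hf H0 Hr.
destruct (MVT_gen f 0 r (fun _ => 0)) as [c [_ Hc]].
- rewrite Rmin_left, Rmax_right by lra; intros x Hx.
  rewrite <- (H0 x) by lra; apply Hf; rewrite Rabs_pos_eq; lra.
- rewrite Rmin_left, Rmax_right by lra; intros x Hx.
  apply continuity_pt_filterlim.
  apply (is_derive_continuous f x (f' x)), Hf; rewrite Rabs_pos_eq; lra.
- lra.
Qed.

Lemma circ_0 th : circ 0 th = 0%C.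
Proof. apply C_eq; simpl; ring. Qed.

Lemma continuous_on_circ (h : C -> C) r th : (forall z, unit_disk z -> continuous h z) ->
  Rabs r < 1 -> continuous (fun s => h (circ r s)) th.
Proof.
intros H Hr; apply (continuous_comp (fun s => circ r s) h).
- apply circ_continuous_th.
- now apply H, circ_in_disk.
Qed.

Lemma RInt_const_circ (c : R) : RInt (fun _ => c) (- PI) PI = 2 * PI * c.
Proof. rewrite RInt_const; unfold scal; simpl; unfold mult; simpl; ring. Qed.

Lemma circ_period r : circ r PI = circ r (- PI).
Proof. unfold circ; rewrite cos_neg, sin_neg, sin_PI; f_equal; ring. Qed.

(** The derivative of the mean in [r] is the integral of [Re (k' e^(i th))],
    which is [1/r] times the [th]-derivative of [Im k] and hence integrates to
    zero over a full period. *)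
Lemma holo_mean (k k' : C -> C) (r : R) : holo k k' -> 0 <= r < 1 ->
  RInt (fun th => Re (k (circ r th))) (- PI) PI = 2 * PI * Re (k 0%C).
Proof.
intros Hk Hr.
assert (E : forall s, RInt (fun th => Re (k (circ s th)) * 1) (- PI) PI
        = RInt (fun th => Re (k (circ s th))) (- PI) PI).
{ intros s; apply RInt_ext; intros x _; apply Rmult_1_r. }
rewrite <- E.
transitivity (RInt (fun th => Re (k (circ 0 th)) * 1) (- PI) PI).
- apply (zero_deriv_const (fun s => RInt (fun th => Re (k (circ s th)) * 1) (- PI) PI)
    (fun s => RInt (fun th => Re (k' (circ s th) * circ 1 th)%C * 1) (- PI) PI)); [| |exact Hr].
  + intros s Hs; apply (deriv_circle_mean (fun z => Re (k z)) k' (fun _ => 1)).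
    * now apply holo_Re.
    * intros z; apply (holo_deriv_continuous k k' z Hk).
    * intros; apply continuous_const.
    * exact Hs.
  + intros s Hs.
    assert (As : Rabs s < 1) by (rewrite Rabs_pos_eq; lra).
    apply is_RInt_unique.
    apply (is_RInt_ext (fun th => / s * Im (k' (circ s th) * (Ci * circ s th))%C)).
    { intros x _; simpl; unfold Re, Im; field; lra. }
    assert (Z : / s * (Im (k (circ s PI)) - Im (k (circ s (- PI)))) = 0).
    { rewrite circ_period; ring. }
    rewrite <- Z.
    apply (is_RInt_scal (V := R_NormedModule)).
    apply (is_RInt_derive (V := R_CompleteNormedModule) (fun th => Im (k (circ s th)))).
    * intros th _; apply (proj1 Hk (fun t => circ s t) th _ (circ_deriv_th s th)); now apply circ_in_disk.
    * intros th _.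
      apply continuous_Im with (h := fun th => (k' (circ s th) * (Ci * circ s th))%C).
      apply continuous_Cmult; [exact (continuous_on_circ k' s th (fun z => holo_deriv_continuous k k' z Hk) As)|].
      apply continuous_Cmult; [apply continuous_const|].
      apply circ_continuous_th.
- rewrite (RInt_ext _ (fun _ => Re (k 0%C))).
  + apply RInt_const_circ.
  + intros x _; rewrite circ_0; apply Rmult_1_r.
Qed.

Lemma deriv_circ_th (u : C -> R) (h : C -> C) r th : has_grad u h -> Rabs r < 1 ->
  is_derive (fun s => u (circ r s)) th (Re (h (circ r th) * (Ci * circ r th))%C).
Proof.
intros Hu Hr; apply (Hu (fun s => circ r s)); [apply circ_deriv_th | now apply circ_in_disk].
Qed.

Lemma disk0 : unit_disk 0%C.
Proof. unfold unit_disk; rewrite Cmod_0; lra. Qed.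

(** The [r]-derivative of the integral is [1/r] times the integral of
    [Re (z * h z)] over the circle, and [z * h z] is a holomorphic function
    vanishing at the origin. *)
Lemma harmonic_mean (u : C -> R) (h h' : C -> C) (r : R) :
  has_grad u h -> holo h h' -> 0 <= r < 1 ->
  RInt (fun th => u (circ r th)) (- PI) PI = 2 * PI * u 0%C.
Proof.
intros Hu Hh Hr.
rewrite <- (RInt_ext (fun th => u (circ r th) * 1)) by (intros; apply Rmult_1_r).
transitivity (RInt (fun th => u (circ 0 th) * 1) (- PI) PI).
- apply (zero_deriv_const (fun s => RInt (fun th => u (circ s th) * 1) (- PI) PI)
    (fun s => RInt (fun th => Re (h (circ s th) * circ 1 th)%C * 1) (- PI) PI)); [| |exact Hr].
  + intros s Hs; apply deriv_circle_mean; auto.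
    * intros z; apply (holo_continuous h h' z Hh).
    * intros; apply continuous_const.
  + intros s Hs.
    assert (As : Rabs s < 1) by (rewrite Rabs_pos_eq; lra).
    rewrite (RInt_ext _ (fun th => scal (/ s) (Re (circ s th * h (circ s th))%C))).
    2: { intros x _; unfold scal; simpl; unfold mult; simpl; unfold Re, Im; field; lra. }
    rewrite (RInt_scal (V := R_CompleteNormedModule)).
    * rewrite (holo_mean (fun z => z * h z)%C _ s (holo_mult _ _ _ _ holo_id Hh)) by lra.
      unfold scal; simpl; unfold mult; simpl; unfold Re, Im; ring.
    * apply (@ex_RInt_continuous R_CompleteNormedModule); intros th _.
      apply (continuous_Re (fun th => circ s th * h (circ s th))%C).
      apply continuous_Cmult.
      -- apply circ_continuous_th.
      -- exact (continuous_on_circ h s th (fun z => holo_continuous h h' z Hh) As).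
- rewrite (RInt_ext _ (fun _ => u 0%C)).
  + apply RInt_const_circ.
  + intros x _; rewrite circ_0; apply Rmult_1_r.
Qed.

(** Let [N] be the cosine moment.  Integrating [N] by parts and adding [r N'],
    the two integrands combine to [r Re h], because
    [e^(i th) (cos th - i sin th) = 1].  So [(r N)' = 2 PI r Re (h 0)] by the
    mean value property of [h]. *)
Lemma harmonic_cos_mean (u : C -> R) (h h' : C -> C) (r : R) :
  has_grad u h -> holo h h' -> 0 < r < 1 ->
  RInt (fun th => u (circ r th) * cos th) (- PI) PI = PI * r * Re (h 0%C).
Proof.
intros Hu Hh Hr.
set (N := fun s => RInt (fun th => u (circ s th) * cos th) (- PI) PI).
set (N' := fun s => RInt (fun th => Re (h (circ s th) * circ 1 th)%C * cos th) (- PI) PI).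
assert (DN : forall s, Rabs s < 1 -> is_derive N s (N' s)).
{ intros s Hs; apply deriv_circle_mean; auto.
  - intros z; apply (holo_continuous h h' z Hh).
  - intros; apply continuous_cos. }
assert (E : r * N r - PI * Re (h 0%C) * r ^ 2 = 0 * N 0 - PI * Re (h 0%C) * 0 ^ 2).
{ apply (zero_deriv_const (fun s => s * N s - PI * Re (h 0%C) * s ^ 2)
    (fun s => N s + s * N' s - PI * Re (h 0%C) * (2 * s))); [| |lra].
  - intros s Hs.
    eapply is_derive_eq.
    + apply (is_derive_minus (fun s => s * N s)).
      * apply Derive.is_derive_mult; [apply is_derive_id | apply DN, Hs].
      * apply is_derive_scal; apply is_derive_pow; apply is_derive_id.
    + unfold minus, plus, opp, one; simpl; ring.
  - intros s Hs.
    assert (As : Rabs s < 1) by (rewrite Rabs_pos_eq; lra).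
    assert (CC : forall th, continuous (fun th => Re (h (circ s th) * (Ci * circ s th))%C) th).
    { intros th; apply (continuous_Re (fun th => h (circ s th) * (Ci * circ s th))%C).
      apply continuous_Cmult; [exact (continuous_on_circ h s th (fun z => holo_continuous h h' z Hh) As)|].
      apply continuous_Cmult; [apply continuous_const|].
      apply circ_continuous_th. }
    (* the th-derivative of u sin, integrated over a full period *)
    assert (I : is_RInt (fun th => u (circ s th) * cos th + Re (h (circ s th) * (Ci * circ s th))%C * sin th) (- PI) PI 0).
    { assert (Z : u (circ s PI) * sin PI - u (circ s (- PI)) * sin (- PI) = 0).
      { rewrite sin_neg, sin_PI; ring. }
      rewrite <- Z.
      apply (is_RInt_derive (V := R_CompleteNormedModule) (fun th => u (circ s th) * sin th)).
      - intros th _. eapply is_derive_eq; [apply Derive.is_derive_mult|].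
        + apply (deriv_circ_th u h); assumption.
        + apply is_derive_sin.
        + apply Rplus_comm.
      - intros th _.
        apply (continuous_Rplus (fun th => u (circ s th) * cos th)); apply continuous_Rmult.
        + eapply has_grad_circ_continuous; eauto.
        + apply continuous_cos.
        + apply CC.
        + apply continuous_sin. }
    assert (I2 : is_RInt (fun th => s * Re (h (circ s th))) (- PI) PI (s * (2 * PI * Re (h 0%C)))).
    { apply (is_RInt_scal (V := R_NormedModule)).
      rewrite <- (holo_mean h h' s Hh) by lra.
      apply (RInt_correct (V := R_CompleteNormedModule)), (@ex_RInt_continuous R_CompleteNormedModule).
      intros th _; apply (continuous_Re (fun th => h (circ s th))).
      exact (continuous_on_circ h s th (fun z => holo_continuous h h' z Hh) As). }
    assert (I3 : is_RInt (fun th => s * (Re (h (circ s th) * circ 1 th)%C * cos th)) (- PI) PI (s * N' s)).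
    { apply (is_RInt_scal (V := R_NormedModule)).
      apply (RInt_correct (V := R_CompleteNormedModule)), (@ex_RInt_continuous R_CompleteNormedModule).
      intros th _; apply continuous_Rmult; [|apply continuous_cos].
      apply (continuous_Re (fun th => h (circ s th) * circ 1 th)%C).
      apply continuous_Cmult; [exact (continuous_on_circ h s th (fun z => holo_continuous h h' z Hh) As)|].
      apply circ_continuous_th. }
    assert (EN : N s = 0 + s * (2 * PI * Re (h 0%C)) - s * N' s).
    { apply is_RInt_unique.
      eapply is_RInt_ext; [|exact (is_RInt_minus _ _ _ _ _ _ (is_RInt_plus _ _ _ _ _ _ I I2) I3)].
      intros th _.
      pose proof (sin2_cos2 th) as SC; unfold Rsqr in SC.
      assert (SC' : sin th * sin th = 1 - cos th * cos th) by lra.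
      unfold plus, minus, opp, plus; simpl; unfold Re, Im.
      ring_simplify. replace (sin th ^ 2) with (1 - cos th ^ 2) by (simpl; lra).
      ring. }
    rewrite EN; ring. }
unfold N in E at 1.
apply (Rmult_eq_reg_l r); [|lra].
transitivity (PI * Re (h 0%C) * r ^ 2); [lra|ring].
Qed.

(** * The Schwarz lemma for real harmonic functions *)

Lemma is_RInt_cos_minus (c s a b : R) :
  is_RInt (fun th => s * (cos th - c)) a b (s * ((sin b - c * b) - (sin a - c * a))).
Proof.
apply (is_RInt_scal (V := R_NormedModule)).
apply (is_RInt_derive (V := R_CompleteNormedModule) (fun th => sin th - c * th)).
- intros x _; auto_derive; auto; ring.
- intros x _; apply (continuous_Rminus cos (fun _ => c)); [apply continuous_cos | apply continuous_const].
Qed.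

(** On an arc where [cos th - c] has the constant sign [s], the extremal [v] is
    the constant [s]. *)
Lemma bang_bang_part (v : R -> R) (c s a b : R) : a <= b ->
  (forall th, continuous v th) -> (forall th, Rabs (v th) <= 1) ->
  s = 1 \/ s = -1 ->
  (forall th, a < th < b -> 0 <= s * (cos th - c)) ->
  RInt (fun th => v th * (cos th - c)) a b <= s * ((sin b - c * b) - (sin a - c * a)).
Proof.
intros Hab Hc Hv Hs Hp.
rewrite <- (is_RInt_unique _ _ _ _ (is_RInt_cos_minus c s a b)).
apply RInt_le; [exact Hab | | eexists; apply is_RInt_cos_minus | ].
- apply (@ex_RInt_continuous R_CompleteNormedModule); intros th _.
  apply continuous_Rmult; [apply Hc|].
  apply (continuous_Rminus cos (fun _ => c)); [apply continuous_cos | apply continuous_const].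
- intros th Hth; specialize (Hp th Hth); specialize (Hv th).
  apply Rabs_le_between in Hv; destruct Hs; subst s; nra.
Qed.

Lemma cos_abs_le a th : 0 <= a <= PI -> - a <= th <= a -> cos a <= cos th.
Proof.
intros Ha Hth.
destruct (Rle_or_lt 0 th).
- apply cos_decr_1; lra.
- rewrite <- (cos_neg th); apply cos_decr_1; lra.
Qed.

(** The bathtub principle: among functions with values in [[-1,1]], the
    integral against [cos th - cos al] is maximal for the one that equals [1]
    for [|th| < al] and [-1] elsewhere. *)
Lemma bang_bang (v : R -> R) (al : R) : 0 <= al <= PI ->
  (forall th, continuous v th) -> (forall th, Rabs (v th) <= 1) ->
  RInt (fun th => v th * (cos th - cos al)) (- PI) PI
    <= 4 * sin al + 2 * cos al * (PI - 2 * al).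
Proof.
intros Hal Hc Hv.
assert (X : forall a b, ex_RInt (fun th => v th * (cos th - cos al)) a b).
{ intros a b; apply (@ex_RInt_continuous R_CompleteNormedModule); intros th _.
  apply continuous_Rmult; [apply Hc|].
  apply (continuous_Rminus cos (fun _ => cos al)); [apply continuous_cos | apply continuous_const]. }
rewrite <- (RInt_Chasles _ (- PI) (- al) PI (X _ _) (X _ _)).
rewrite <- (RInt_Chasles _ (- al) al PI (X _ _) (X _ _)).
unfold plus; simpl.
assert (B1 := bang_bang_part v (cos al) (-1) (- PI) (- al) ltac:(lra) Hc Hv ltac:(auto)).
assert (B2 := bang_bang_part v (cos al) 1 (- al) al ltac:(lra) Hc Hv ltac:(auto)).
assert (B3 := bang_bang_part v (cos al) (-1) al PI ltac:(lra) Hc Hv ltac:(auto)).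
rewrite ?sin_neg, ?sin_PI in *.
lapply B1; [clear B1; intros B1|].
lapply B2; [clear B2; intros B2|].
lapply B3; [clear B3; intros B3|].
- lra.
- intros th Hth. assert (cos th <= cos al) by (apply cos_decr_1; lra). lra.
- intros th Hth. assert (cos al <= cos th) by (apply cos_abs_le; lra). lra.
- intros th Hth. rewrite <- (cos_neg th).
  assert (cos (- th) <= cos al) by (apply cos_decr_1; lra). lra.
Qed.

(** Concavity of the sine on [[0, PI/4]]: its graph lies above the chord, since
    the slopes that the mean value theorem gives on the two sides of [t] are
    ordered because the cosine decreases. *)
Lemma sin_quarter (t : R) : 0 <= t <= 1 -> t * sin (PI / 4) <= sin (t * (PI / 4)).
Proof.
intros Ht; pose proof PI_RGT_0 as P.
set (f := fun t => sin (t * (PI / 4)) - t * sin (PI / 4)).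
set (f' := fun t => PI / 4 * cos (t * (PI / 4)) - sin (PI / 4)).
assert (D : forall x, is_derive f x (f' x)).
{ intros x; unfold f, f'; auto_derive; auto; ring. }
assert (K : forall x, continuity_pt f x).
{ intros x; apply continuity_pt_filterlim; exact (is_derive_continuous _ _ _ (D x)). }
destruct (MVT_gen f 0 t f') as [c1 [H1 E1]]; auto.
destruct (MVT_gen f t 1 f') as [c2 [H2 E2]]; auto.
rewrite Rmin_left, Rmax_right in H1, H2 by lra.
assert (C : f' c2 <= f' c1).
{ unfold f'. assert (cos (c2 * (PI / 4)) <= cos (c1 * (PI / 4))).
  { assert (J : forall c, 0 <= c <= 1 -> 0 <= c * (PI / 4) <= PI) by (intros; split; nra).
    destruct (J c1 ltac:(lra)), (J c2 ltac:(lra)).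
    apply cos_decr_1; try assumption; apply Rmult_le_compat_r; lra. }
  apply Rplus_le_compat_r, Rmult_le_compat_l; lra. }
assert (Z0 : f 0 = 0) by (unfold f; rewrite !Rmult_0_l, sin_0; ring).
assert (Z1 : f 1 = 0) by (unfold f; rewrite !Rmult_1_l; ring).
rewrite Z0 in E1; rewrite Z1 in E2.
assert (0 <= f t).
{ replace (f t) with (t * (1 - t) * (f' c1 - f' c2)).
  - apply Rmult_le_pos; [apply Rmult_le_pos|]; lra.
  - replace (t * (1 - t) * (f' c1 - f' c2))
      with ((1 - t) * (f' c1 * (t - 0)) - t * (f' c2 * (1 - t))) by ring.
    rewrite <- E1, <- E2; ring. }
unfold f in *; lra.
Qed.

(** By [cos (2x) = 1 - 2 sin^2 x] this is the chord estimate for the sine on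
    [[0, PI/4]], where [2 sin^2 (PI/4) = 1]. *)
Lemma cos_le_parabola (m : R) : -1 <= m <= 1 -> cos (PI * m / 2) <= 1 - m ^ 2.
Proof.
assert (W : forall m, 0 <= m <= 1 -> cos (PI * m / 2) <= 1 - m ^ 2).
{ clear m; intros m Hm.
  replace (PI * m / 2) with (2 * (m * (PI / 4))) by field.
  rewrite cos_2a_sin.
  pose proof (sin_quarter m Hm) as S.
  rewrite sin_PI4 in S.
  assert (Q : 0 < / sqrt 2) by (apply Rinv_0_lt_compat, sqrt_lt_R0; lra).
  assert (Q2 : 2 * (1 / sqrt 2 * (1 / sqrt 2)) = 1).
  { pose proof (sqrt_sqrt 2 ltac:(lra)). assert (sqrt 2 <> 0) by (intros E; rewrite E in *; lra).
    replace (2 * (1 / sqrt 2 * (1 / sqrt 2))) with (2 / (sqrt 2 * sqrt 2)) by (field; assumption).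
    rewrite H; field. }
  set (q := 1 / sqrt 2) in *.
  assert (0 < q) by (unfold q; lra).
  set (y := sin (m * (PI / 4))) in *.
  assert (m * q * (m * q) <= y * y) by (apply Rmult_le_compat; nra).
  nra. }
intros Hm; destruct (Rle_or_lt 0 m); [apply W; lra|].
replace (PI * m / 2) with (- (PI * (- m) / 2)) by field.
rewrite cos_neg; replace (m ^ 2) with ((- m) ^ 2) by ring; apply W; lra.
Qed.

(** Lets the radius of the circle tend to [1] in the estimate at the origin. *)
Lemma le_of_scaled (x K : R) : (forall r, 0 < r < 1 -> r * x <= K) -> x <= K.
Proof.
intros H; destruct (Rle_or_lt x K) as [|L]; [assumption|].
exfalso.
assert (HK : 0 < x \/ x <= 0) by lra.
destruct HK as [Hx|Hx].
- destruct (Rle_or_lt K 0).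
  + specialize (H (/ 2)); lra.
  + assert (0 < K / x < 1).
    { split; [now apply Rdiv_lt_0_compat|]. apply (Rmult_lt_reg_r x); [lra|].
      unfold Rdiv; rewrite Rmult_assoc, Rinv_l; lra. }
    specialize (H ((1 + K / x) / 2) ltac:(lra)).
    replace ((1 + K / x) / 2 * x) with ((x + K) / 2) in H by (field; lra). lra.
- specialize (H (/ 2)); lra.
Qed.

(** The choice [al = PI (1 + u 0) / 2] is the arc whose jump function has mean
    value [u 0]: then the terms with [cos al] cancel in the bathtub inequality
    and [PI r Re (h 0) <= 4 sin al] remains. *)
Lemma grad_bound_0 (u : C -> R) (h h' : C -> C) :
  has_grad u h -> holo h h' -> (forall z, unit_disk z -> Rabs (u z) <= 1) ->
  Re (h 0%C) <= 4 / PI * (1 - u 0%C ^ 2).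
Proof.
intros Hu Hh H1; pose proof PI_RGT_0 as P.
assert (B := H1 _ disk0); apply Rabs_le_between in B.
apply Rle_trans with (4 / PI * cos (PI * u 0%C / 2)).
2: { apply Rmult_le_compat_l; [apply Rlt_le, Rdiv_lt_0_compat; lra|]. now apply cos_le_parabola. }
apply le_of_scaled; intros r Hr.
assert (Ar : Rabs r < 1) by (rewrite Rabs_pos_eq; lra).
set (al := PI * (1 + u 0%C) / 2).
assert (Hal : 0 <= al <= PI) by (unfold al; nra).
assert (Cu : forall th, continuous (fun s => u (circ r s)) th)
  by (intros; eapply has_grad_circ_continuous; eauto).
assert (BB := bang_bang (fun th => u (circ r th)) al Hal Cu
  ltac:(intros; apply H1, circ_in_disk, Ar)).
assert (E : RInt (fun th => u (circ r th) * (cos th - cos al)) (- PI) PI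
   = PI * r * Re (h 0%C) - cos al * (2 * PI * u 0%C)).
{ apply is_RInt_unique.
  eapply is_RInt_ext; [|apply (is_RInt_minus (V := R_NormedModule)
     (fun th => u (circ r th) * cos th) (fun th => cos al * u (circ r th)))].
  - intros x _; unfold minus, plus, opp; simpl; ring.
  - rewrite <- (harmonic_cos_mean u h h' r Hu Hh Hr).
    apply (RInt_correct (V := R_CompleteNormedModule)), (@ex_RInt_continuous R_CompleteNormedModule).
    intros th _; apply continuous_Rmult; [apply Cu | apply continuous_cos].
  - apply (is_RInt_scal (V := R_NormedModule)).
    rewrite <- (harmonic_mean u h h' r Hu Hh) by lra.
    apply (RInt_correct (V := R_CompleteNormedModule)), (@ex_RInt_continuous R_CompleteNormedModule).
    intros th _; apply Cu. }
cbv beta in BB; rewrite E in BB.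
replace (cos (PI * u 0%C / 2)) with (sin al).
2: { rewrite <- sin_shift, <- (sin_PI_x al); f_equal; unfold al; field. }
assert (F : PI * r * Re (h 0%C) <= 4 * sin al).
{ replace (PI - 2 * al) with (- PI * u 0%C) in BB by (unfold al; field). nra. }
apply (Rmult_le_reg_l PI); [lra|].
replace (PI * (4 / PI * sin al)) with (4 * sin al) by (field; lra). lra.
Qed.

(** ** Disk automorphisms *)

Definition mob (a z : C) : C := ((z + a) * / (1 + Cconj a * z))%C.
Definition mob' (a z : C) : C :=
  (RtoC (1 - Cmod a ^ 2) * (/ (1 + Cconj a * z) * / (1 + Cconj a * z)))%C.

Lemma mob_den (a z : C) : unit_disk a -> unit_disk z -> (1 + Cconj a * z)%C <> 0%C.
Proof.
intros Ha Hz E; unfold unit_disk in *.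
assert (Q : (Cconj a * z)%C = RtoC (-1)).
{ apply C_eq; [apply (f_equal Re) in E | apply (f_equal Im) in E];
  simpl in *; unfold Re, Im in *; simpl in *; lra. }
apply (f_equal Cmod) in Q; rewrite Cmod_mult, Cmod_conj, Cmod_R in Q.
replace (Rabs (-1)) with 1 in Q by (rewrite Rabs_left; lra).
pose proof (Cmod_ge_0 a); pose proof (Cmod_ge_0 z); nra.
Qed.

Lemma mob_norm (a z : C) : unit_disk a -> unit_disk z ->
  1 - Cmod (mob a z) ^ 2 = (1 - Cmod a ^ 2) * (1 - Cmod z ^ 2) / Cmod (1 + Cconj a * z)%C ^ 2.
Proof.
intros Ha Hz; pose proof (mob_den a z Ha Hz) as D.
assert (D' : Cmod (1 + Cconj a * z)%C <> 0).
{ apply Cmod_gt_0 in D; lra. }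
unfold mob; rewrite Cmod_mult, Cmod_inv by exact D.
assert (E : Cmod (1 + Cconj a * z)%C ^ 2 - Cmod (z + a)%C ^ 2
   = (1 - Cmod a ^ 2) * (1 - Cmod z ^ 2)).
{ rewrite !Cmod_sqr; simpl; unfold Re, Im; ring. }
rewrite <- E; field; exact D'.
Qed.

Lemma disk_one_minus_sqr_pos z : unit_disk z -> 0 < 1 - Cmod z ^ 2.
Proof. unfold unit_disk; pose proof (Cmod_ge_0 z); intros; nra. Qed.

Lemma mob_disk (a z : C) : unit_disk a -> unit_disk z -> unit_disk (mob a z).
Proof.
intros Ha Hz; pose proof (mob_den a z Ha Hz) as D; apply Cmod_gt_0 in D.
apply unit_disk_sqr; rewrite <- Cmod_sqr.
enough (0 < 1 - Cmod (mob a z) ^ 2) by lra.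
rewrite mob_norm by assumption; apply Rdiv_lt_0_compat.
- apply Rmult_lt_0_compat; now apply disk_one_minus_sqr_pos.
- nra.
Qed.

(** Disk automorphisms are isometries of the hyperbolic metric
    [|dz| / (1 - |z|^2)]. *)
Lemma mob'_norm (a z : C) : unit_disk a -> unit_disk z ->
  Cmod (mob' a z) * (1 - Cmod z ^ 2) = 1 - Cmod (mob a z) ^ 2.
Proof.
intros Ha Hz; rewrite mob_norm by assumption.
pose proof (mob_den a z Ha Hz) as D.
assert (D' : Cmod (1 + Cconj a * z)%C <> 0).
{ apply Cmod_gt_0 in D; lra. }
unfold mob'; rewrite !Cmod_mult, Cmod_inv, Cmod_R by exact D.
rewrite Rabs_pos_eq by (apply Rlt_le, disk_one_minus_sqr_pos, Ha).
field; exact D'.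
Qed.

Lemma holo_mob_den (a : C) : unit_disk a ->
  holo (fun z => 1 + Cconj a * z)%C (fun _ => Cconj a).
Proof.
intros Ha; eapply holo_ext;
 [| exact (holo_plus _ _ _ _ (holo_const 1%C) (holo_mult _ _ _ _ (holo_const (Cconj a)) holo_id)) |].
- intros z _; simpl; ring.
- intros; apply continuous_const.
Qed.

Lemma holo_mob (a : C) : unit_disk a -> holo (mob a) (mob' a).
Proof.
intros Ha.
pose proof (holo_inv _ _ (holo_mob_den a Ha) (fun z => mob_den a z Ha)) as Hi.
eapply holo_ext; [|exact (holo_mult _ _ _ _ (holo_plus _ _ _ _ holo_id (holo_const a)) Hi)|].
- intros z Hz; pose proof (mob_den a z Ha Hz) as D; unfold mob'; cbv beta.
  assert (E : RtoC (1 - Cmod a ^ 2) = (1 - a * Cconj a)%C).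
  { rewrite Cmod_sqr; apply C_eq; simpl; unfold Re, Im; simpl; ring. }
  rewrite E; field; exact D.
- intros z Hz; destruct (proj2 Hi z Hz) as [Hc _].
  unfold mob'; apply continuous_Cmult; [apply continuous_const|].
  now apply continuous_Cmult.
Qed.

(** The continuous second derivative of [mob a] makes the gradient
    [h (mob a z) * mob' a z] of [u o mob a] holomorphic. *)
Lemma holo_mob' (a : C) : unit_disk a -> exists m, holo (mob' a) m.
Proof.
intros Ha.
pose proof (holo_inv _ _ (holo_mob_den a Ha) (fun z => mob_den a z Ha)) as Hi.
eexists; exact (holo_mult _ _ _ _ (holo_const _) (holo_mult _ _ _ _ Hi Hi)).
Qed.

Lemma rotation_to_real (z : C) : exists w, Cmod w = 1 /\ (z * w)%C = RtoC (Cmod z).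
Proof.
destruct (Ceq_dec z 0) as [->|N].
- exists 1%C; rewrite Cmod_1, Cmod_0; split; [reflexivity|ring].
- pose proof (proj1 (Cmod_gt_0 z) N) as P.
  assert (Q : RtoC (Cmod z) <> 0%C) by (intros E; injection E; lra).
  exists (Cconj z * / RtoC (Cmod z))%C; split.
  + rewrite Cmod_mult, Cmod_conj, Cmod_inv, Cmod_R, Rabs_pos_eq by (exact Q || lra).
    field; lra.
  +    assert (E : (z * Cconj z)%C = (RtoC (Cmod z) * RtoC (Cmod z))%C).
    { rewrite <- RtoC_mult; replace (Cmod z * Cmod z) with (Cmod z ^ 2) by ring.
      rewrite Cmod_sqr; apply C_eq; simpl; unfold Re, Im; simpl; ring. }
    rewrite Cmult_assoc, E; field; exact Q.
Qed.

Lemma holo_rot (w : C) : holo (fun z => w * z)%C (fun _ => w).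
Proof.
eapply holo_ext; [|exact (holo_mult _ _ _ _ (holo_const w) holo_id)|].
- intros z _; simpl; ring.
- intros; apply continuous_const.
Qed.

Lemma rot_disk w z : Cmod w = 1 -> unit_disk z -> unit_disk (w * z)%C.
Proof. unfold unit_disk; rewrite Cmod_mult; intros ->; now rewrite Rmult_1_l. Qed.

Lemma mob_0 a : mob a 0%C = a.
Proof. unfold mob; field; rewrite Cmult_0_r, Cplus_0_r; exact C1_nz. Qed.

(** The automorphism [z |-> mob a (w z)] sends the origin to [a], and the
    unimodular [w] makes the gradient of the composition at the origin a
    non-negative real number, so that its [x]-component is its length. *)
Lemma grad_bound (u : C -> R) (h h' : C -> C) (a : C) :
  has_grad u h -> holo h h' -> (forall z, unit_disk z -> Rabs (u z) <= 1) ->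
  unit_disk a ->
  Cmod (h a) * (1 - Cmod a ^ 2) <= 4 / PI * (1 - u a ^ 2).
Proof.
intros Hu Hh H1 Ha.
destruct (rotation_to_real (h a)) as [w [Hw Ew]].
destruct (holo_mob' a Ha) as [m Hm].
set (p := fun z => mob a (w * z)%C).
assert (HR : forall z, unit_disk z -> unit_disk (w * z)%C) by (intros; now apply rot_disk).
assert (HP : forall z, unit_disk z -> unit_disk (p z)) by (intros; apply mob_disk; auto).
assert (Hp := holo_comp _ _ _ _ (holo_mob a Ha) (holo_rot w) HR).
assert (Hp' := holo_mult _ _ _ _ (holo_comp _ _ _ _ Hm (holo_rot w) HR) (holo_const w)).
assert (G := grad_bound_0 (fun z => u (p z)) _ _ (has_grad_comp u h _ _ Hu Hp HP)
   (holo_mult _ _ _ _ (holo_comp _ _ _ _ Hh Hp HP) Hp')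
   (fun z Hz => H1 _ (HP z Hz))).
unfold p in G; cbv beta in G; rewrite Cmult_0_r, mob_0 in G.
replace (h a * (mob' a 0 * w))%C with (RtoC (Cmod (h a) * (1 - Cmod a ^ 2))) in G.
- exact G.
- rewrite RtoC_mult, <- Ew; unfold mob'.
  field.
Qed.

(** The factor [(be - u a) (u a - al) / (be - al)], a harmonic mean of the
    distances to the two ends up to a constant, is what [1 - u^2] becomes when
    [[al, be]] is mapped affinely to [[-1, 1]] and the gradient is scaled back. *)
Lemma grad_bound_interval (u : C -> R) (h h' : C -> C) (al be : R) (a : C) :
  has_grad u h -> holo h h' -> al < be ->
  (forall z, unit_disk z -> al <= u z <= be) -> unit_disk a ->
  Cmod (h a) * (1 - Cmod a ^ 2) <= 8 / PI * ((be - u a) * (u a - al) / (be - al)).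
Proof.
intros Hu Hh Hab H1 Ha.
set (k := 2 / (be - al)).
assert (Hk : 0 < k) by (apply Rdiv_lt_0_compat; lra).
set (v := fun z => k * (u z - al) - 1).
pose proof (fun k' => grad_bound v (fun z => RtoC k * h z)%C k' a) as G.
assert (Hv : has_grad v (fun z => RtoC k * h z)%C).
{ intros c t d Hc Hd; unfold v.
  eapply is_derive_eq.
  - apply (is_derive_minus (fun s => k * (u (c s) - al)) (fun _ => 1)).
    + apply is_derive_scal, (is_derive_minus (fun s => u (c s)) (fun _ => al)).
      * exact (Hu c t d Hc Hd).
      * exact (is_derive_const al t).
    + exact (is_derive_const 1 t).
  - unfold minus, plus, opp, zero; simpl; unfold Re, Im; ring. }
specialize (G _ Hv (holo_mult _ _ _ _ (holo_const k) Hh)).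
lapply G; [clear G; intros G; specialize (G Ha)|].
- rewrite Cmod_mult, Cmod_R, Rabs_pos_eq in G by lra.
  apply (Rmult_le_reg_l k); [exact Hk|].
  rewrite <- Rmult_assoc; apply Rle_trans with (1 := G).
  apply Req_le; unfold v, k; field; split; [lra | apply PI_neq0].
- intros z Hz; specialize (H1 z Hz); apply Rabs_le; unfold v.
  assert (E : k * (be - al) = 2) by (unfold k; field; lra).
  split; nra.
Qed.

(** * Metrics of non-negative curvature *)

Section Metric.
Variable Rm : R -> R.
Hypothesis HR : smooth_metric Rm.
Hypothesis HK : nonneg_curvature Rm.

Lemma metric_pos u : -1 < u < 1 -> 0 < Rm u.
Proof. intros Hu; apply (HR u Hu). Qed.

Lemma metric_deriv u : -1 < u < 1 -> is_derive Rm u (Derive Rm u).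
Proof. intros Hu; apply Derive_correct; exact (proj2 (HR u Hu) 1%nat). Qed.

Lemma metric_deriv2 u : -1 < u < 1 -> ex_derive (Derive Rm) u.
Proof. intros Hu; exact (proj2 (HR u Hu) 2%nat). Qed.

Lemma metric_cont u : -1 < u < 1 -> continuous Rm u.
Proof. intros Hu; eapply is_derive_continuous, metric_deriv, Hu. Qed.

Lemma between_in (s t c : R) : -1 < s < 1 -> -1 < t < 1 ->
  Rmin s t <= c <= Rmax s t -> -1 < c < 1.
Proof.
intros Hs Ht; unfold Rmin, Rmax; destruct (Rle_dec s t); lra.
Qed.

(** Log-concavity of [Rm]: up to the positive factor [1 / Rm^2] the curvature is
    minus the derivative of the logarithmic derivative. *)
Lemma logderiv_antitone s t : -1 < s -> s <= t -> t < 1 ->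
  Derive Rm t / Rm t <= Derive Rm s / Rm s.
Proof.
intros Hs Hst Ht.
set (psi := fun u => Derive Rm u / Rm u).
assert (D : forall u, -1 < u < 1 -> is_derive psi u (Derive psi u)).
{ intros u Hu; apply Derive_correct, ex_derive_div.
  - now apply metric_deriv2.
  - eexists; now apply metric_deriv.
  - apply Rgt_not_eq; now apply metric_pos. }
destruct (MVT_gen psi s t (Derive psi)) as [c [Hc E]].
- intros x Hx; apply D; apply (between_in s t); lra.
- intros x Hx; apply continuity_pt_filterlim; eapply is_derive_continuous, D, (between_in s t); lra.
- assert (Hc' : -1 < c < 1) by (apply (between_in s t); lra).
  assert (K := HK c Hc'); unfold gaussian_curvature in K; fold psi in K.
  assert (P := metric_pos c Hc').
  assert (Q : 0 < 1 / Rm c ^ 2) by (apply Rdiv_lt_0_compat; nra).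
  assert (Derive psi c <= 0) by nra.
  change (psi t <= psi s); nra.
Qed.

(** A concave function, here [ln Rm], lies below its tangent line at [t]. *)
Lemma metric_le_exp s t : -1 < s < 1 -> -1 < t < 1 ->
  Rm s <= Rm t * exp (Derive Rm t / Rm t * (s - t)).
Proof.
intros Hs Ht.
assert (D : forall u, -1 < u < 1 -> is_derive (fun x => ln (Rm x)) u (Derive Rm u / Rm u)).
{ intros u Hu.
  eapply is_derive_eq; [apply (is_derive_comp ln Rm)|].
  - apply is_derive_ln; now apply metric_pos.
  - now apply metric_deriv.
  - reflexivity. }
destruct (MVT_gen (fun x => ln (Rm x)) t s (fun u => Derive Rm u / Rm u)) as [c [Hc E]].
- intros x Hx; apply D; apply (between_in t s); lra.
- intros x Hx; apply continuity_pt_filterlim; apply (is_derive_continuous _ _ _ (D x (between_in t s x Ht Hs Hx))).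
- rewrite <- (exp_ln (Rm s)) by now apply metric_pos.
  rewrite <- (exp_ln (Rm t)) at 1 by now apply metric_pos.
  rewrite <- exp_plus; idtac.
  assert (L : ln (Rm s) <= ln (Rm t) + Derive Rm t / Rm t * (s - t)).
  { cut (Derive Rm c / Rm c * (s - t) <= Derive Rm t / Rm t * (s - t)); [lra|].
    unfold Rmin, Rmax in Hc; destruct (Rle_dec t s).
    - apply Rmult_le_compat_r; [lra|]; apply logderiv_antitone; lra.
    - assert (Derive Rm t / Rm t <= Derive Rm c / Rm c) by (apply logderiv_antitone; lra). nra. }
  destruct L as [L|L]; [left; now apply exp_increasing | right; now rewrite L].
Qed.

(** Isometric coordinate for the metric: postcomposition with it turns
    [R]-harmonic functions into harmonic functions. *)
Definition flattening (t : R) : R := RInt Rm 0 t.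

Lemma metric_ex_RInt s t : -1 < s < 1 -> -1 < t < 1 -> ex_RInt Rm s t.
Proof.
intros Hs Ht; apply (@ex_RInt_continuous R_CompleteNormedModule); intros z Hz.
apply metric_cont, (between_in s t); assumption.
Qed.

Lemma flattening_deriv t : -1 < t < 1 -> is_derive flattening t (Rm t).
Proof.
intros Ht; apply (is_derive_RInt Rm flattening 0 t); [|now apply metric_cont].
apply (locally_interval _ t (-1) 1); simpl; try lra.
intros y H1 H2; apply (RInt_correct (V := R_CompleteNormedModule)), metric_ex_RInt; lra.
Qed.

Lemma flattening_diff s t : -1 < s < 1 -> -1 < t < 1 ->
  flattening t = flattening s + RInt Rm s t.
Proof.
intros Hs Ht; unfold flattening.
symmetry; apply (RInt_Chasles (V := R_CompleteNormedModule) Rm 0 s t);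
apply metric_ex_RInt; lra.
Qed.

Definition exp_majorant (t u : R) : R := Rm t * exp (Derive Rm t / Rm t * (u - t)).

Lemma majorant_deriv t u :
  is_derive (exp_majorant t) u (Derive Rm t / Rm t * exp_majorant t u).
Proof.
unfold exp_majorant; generalize (Derive Rm t / Rm t), (Rm t); intros k p.
auto_derive; auto; unfold Rminus; ring.
Qed.

Lemma majorant_cont t u : continuous (exp_majorant t) u.
Proof. eapply is_derive_continuous, majorant_deriv. Qed.

Lemma majorant_ex_RInt t a b : ex_RInt (exp_majorant t) a b.
Proof. apply (@ex_RInt_continuous R_CompleteNormedModule); intros; apply majorant_cont. Qed.

Lemma majorant_pos t u : -1 < t < 1 -> 0 < exp_majorant t u.
Proof. intros Ht; apply Rmult_lt_0_compat; [now apply metric_pos | apply exp_pos]. Qed.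

Lemma majorant_self t : exp_majorant t t = Rm t.
Proof. unfold exp_majorant; rewrite Rminus_diag, Rmult_0_r, exp_0; ring. Qed.

Lemma majorant_RInt_pos t a b : -1 < t < 1 -> a <= b -> 0 <= RInt (exp_majorant t) a b.
Proof.
intros Ht Hab; apply RInt_ge_0; [exact Hab | apply majorant_ex_RInt|].
intros; apply Rlt_le; now apply majorant_pos.
Qed.

(** Multiplying the integral by the logarithmic derivative, instead of dividing
    the right-hand side by it, also covers the case where it vanishes. *)
Lemma majorant_RInt_scal t a b :
  Derive Rm t / Rm t * RInt (exp_majorant t) a b = exp_majorant t b - exp_majorant t a.
Proof.
set (k := Derive Rm t / Rm t).
transitivity (RInt (fun u => k * exp_majorant t u) a b).
- symmetry; apply (RInt_scal (V := R_CompleteNormedModule)), majorant_ex_RInt.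
- apply is_RInt_unique, (is_RInt_derive (V := R_CompleteNormedModule) (exp_majorant t)).
  + intros; apply majorant_deriv.
  + intros; apply (continuous_scal_r (V := R_NormedModule) k (exp_majorant t)), majorant_cont.
Qed.

(** The trapezoid rule overestimates the integral of a convex function.  The
    difference of the two sides is the integral of
    [E a - E u + (u - a) E' u], and [E a] lies above the tangent line of [E]
    at [u]. *)
Lemma majorant_trapezoid t a b : -1 < t < 1 -> a <= b ->
  2 * RInt (exp_majorant t) a b <= (b - a) * (exp_majorant t a + exp_majorant t b).
Proof.
intros Ht Hab.
set (E := exp_majorant t); set (k := Derive Rm t / Rm t).
assert (I : is_RInt (fun u => E a + E u + (u - a) * (k * E u)) a b ((b - a) * (E a + E b) - (a - a) * (E a + E a))).
{ apply (is_RInt_derive (V := R_CompleteNormedModule) (fun u => (u - a) * (E a + E u))).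
  - intros u _; assert (D := majorant_deriv t u); fold E k in D.
    eapply is_derive_eq; [apply Derive.is_derive_mult|].
    + apply (is_derive_minus (fun u => u) (fun _ => a)); [apply is_derive_id | apply is_derive_const].
    + apply (is_derive_plus (fun _ => E a) E); [apply is_derive_const | exact D].
    + unfold minus, plus, opp, zero, one; simpl; ring.
  - intros u _; assert (Cu : continuous E u) by apply majorant_cont.
    apply (continuous_Rplus (fun u => E a + E u)).
    + apply (continuous_Rplus (fun _ => E a)); [apply continuous_const | exact Cu].
    + apply (continuous_Rmult (fun u => u - a)).
      * apply (is_derive_continuous (fun u => u - a) u 1); auto_derive; auto; ring.
      * apply (continuous_Rmult (fun _ => k)); [apply continuous_const | exact Cu]. }
replace ((b - a) * (E a + E b)) with ((b - a) * (E a + E b) - (a - a) * (E a + E a)) by ring.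
rewrite <- (is_RInt_unique _ _ _ _ I).
assert (I2 : is_RInt (fun u => 2 * E u) a b (2 * RInt E a b)).
{ apply (is_RInt_scal (V := R_NormedModule)), (RInt_correct (V := R_CompleteNormedModule)), majorant_ex_RInt. }
rewrite <- (is_RInt_unique _ _ _ _ I2).
apply RInt_le; [exact Hab | eexists; exact I2 | eexists; exact I |].
intros u Hu.
assert (X : E a = E u * exp (k * (a - u))).
{ unfold E, exp_majorant; fold k; rewrite Rmult_assoc, <- exp_plus; do 2 f_equal; ring. }
assert (Y := exp_ineq1_le (k * (a - u))).
assert (P : 0 < E u) by (now apply majorant_pos).
rewrite X; nra.
Qed.

(** The flattened values lie in a bounded interval around [flattening t],
    although [Rm] has no prescribed behaviour at [-1] and [1]: the exponential
    majorant is integrable up to both ends. *)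
Lemma flattening_range s t : -1 < s < 1 -> -1 < t < 1 ->
  flattening t - RInt (exp_majorant t) (-1) t <= flattening s
    <= flattening t + RInt (exp_majorant t) t 1.
Proof.
intros Hs Ht.
assert (PA := majorant_RInt_pos t (-1) t Ht ltac:(lra)).
assert (PB := majorant_RInt_pos t t 1 Ht ltac:(lra)).
assert (L : forall a b, -1 < a -> a <= b -> b < 1 -> 0 <= RInt Rm a b <= RInt (exp_majorant t) a b).
{ intros a b Ha Hab Hb; split.
  - apply RInt_ge_0; [exact Hab | apply metric_ex_RInt; lra|].
    intros; apply Rlt_le, metric_pos; lra.
  - apply RInt_le; [exact Hab | apply metric_ex_RInt; lra | apply majorant_ex_RInt|].
    intros; apply metric_le_exp; lra. }
destruct (Rle_or_lt t s) as [H|H].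
- rewrite (flattening_diff t s) by assumption.
  destruct (L t s) as [L1 L2]; try lra.
  assert (Q := RInt_Chasles (V := R_CompleteNormedModule) _ _ _ _ (majorant_ex_RInt t t s) (majorant_ex_RInt t s 1)).
  unfold plus in Q; simpl in Q.
  assert (PC := majorant_RInt_pos t s 1 Ht ltac:(lra)). lra.
- rewrite (flattening_diff s t) by assumption.
  destruct (L s t) as [L1 L2]; try lra.
  assert (Q := RInt_Chasles (V := R_CompleteNormedModule) _ _ _ _ (majorant_ex_RInt t (-1) s) (majorant_ex_RInt t s t)).
  unfold plus in Q; simpl in Q.
  assert (PC := majorant_RInt_pos t (-1) s Ht ltac:(lra)). lra.
Qed.

Lemma majorant_RInt_spos t a b : -1 < t < 1 -> a < b -> 0 < RInt (exp_majorant t) a b.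
Proof.
intros Ht Hab; apply RInt_gt_0; [exact Hab | |].
- intros; now apply majorant_pos.
- intros; apply majorant_cont.
Qed.

(** With [p = Rm t] and [k] the logarithmic derivative, the trapezoid rule reads
    [2 A <= (1 + t) (2 p - k A)] and [2 B <= (1 - t) (2 p + k B)].  In the
    combination with weights [(1 - t) B] and [(1 + t) A] the terms in [k]
    cancel. *)
Lemma majorant_harmonic_mean t : -1 < t < 1 ->
  let A := RInt (exp_majorant t) (-1) t in
  let B := RInt (exp_majorant t) t 1 in
  2 * (A * B / (A + B)) <= Rm t * (1 - t ^ 2).
Proof.
intros Ht A B.
assert (PA : 0 < A) by (apply majorant_RInt_spos; lra).
assert (PB : 0 < B) by (apply majorant_RInt_spos; lra).
assert (TA := majorant_trapezoid t (-1) t Ht ltac:(lra)); fold A in TA.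
assert (TB := majorant_trapezoid t t 1 Ht ltac:(lra)); fold B in TB.
assert (SA := majorant_RInt_scal t (-1) t); fold A in SA.
assert (SB := majorant_RInt_scal t t 1); fold B in SB.
rewrite majorant_self in *.
set (k := Derive Rm t / Rm t) in *; set (p := Rm t) in *.
assert (TA' : 2 * A <= (t + 1) * (2 * p - k * A)) by nra.
assert (TB' : 2 * B <= (1 - t) * (2 * p + k * B)) by nra.
apply (Rmult_le_reg_r (A + B)); [lra|].
replace (2 * (A * B / (A + B)) * (A + B)) with (2 * (A * B)) by (field; lra).
assert (M1 : (2 * A) * ((1 - t) * B) <= ((t + 1) * (2 * p - k * A)) * ((1 - t) * B))
  by (apply Rmult_le_compat_r; nra).
assert (M2 : (2 * B) * ((1 + t) * A) <= ((1 - t) * (2 * p + k * B)) * ((1 + t) * A))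
  by (apply Rmult_le_compat_r; nra).
nra.
Qed.
End Metric.

(** * From [R]-harmonic to harmonic functions *)

Lemma disk_open (z : C) : unit_disk z -> locally z unit_disk.
Proof.
intros Hz.
assert (K : continuous (fun w : C => Re w * Re w + Im w * Im w) z).
{ destruct z as [x y].
  apply (continuous_Rplus (fun w : C => Re w * Re w)); apply continuous_Rmult;
  (apply continuous_fst || apply continuous_snd). }
assert (L : Re z * Re z + Im z * Im z < 1) by (apply unit_disk_sqr in Hz; lra).
apply filter_imp with (fun w : C => Re w * Re w + Im w * Im w < 1);
 [|exact (K (fun v => v < 1) (open_lt 1 _ L))].
intros w Hw; apply unit_disk_sqr; lra.
Qed.

Lemma C1_differentiable (f : C -> R) (x y : R) : C1_on unit_disk f -> unit_disk (x, y) ->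
  filterdiff (fun u : R * R => f (fst u, snd u)) (locally (x, y))
    (fun u : R * R => plus (scal (fst u) (dx f (x, y))) (scal (snd u) (dy f (x, y)))).
Proof.
intros Hf Hd; destruct (Hf _ Hd) as [_ [Dy [Cx _]]].
apply (is_derive_filterdiff (fun a b => f (a, b)) x y (fun a b => dx f (a, b)) (dy f (x, y))).
- apply filter_imp with (2 := disk_open _ Hd); intros [a b] Hab.
  apply Derive_correct; exact (proj1 (Hf _ Hab)).
- apply Derive_correct; exact Dy.
- apply (continuous_ext (dx f)); [now intros []|exact Cx].
Qed.

Lemma C1_has_grad (f : C -> R) : C1_on unit_disk f ->
  has_grad f (fun z => (dx f z, - dy f z)).
Proof.
intros Hf c t d [H1 H2] Hd.
destruct (c t) as [x y] eqn:E.
assert (Ex : x = Re (c t)) by (now rewrite E).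
assert (Ey : y = Im (c t)) by (now rewrite E).
assert (F := C1_differentiable f x y Hf Hd).
apply (filterdiff_differentiable_pt_lim (fun a b => f (a, b))) in F.
apply (is_derive_ext (fun s => f (Re (c s), Im (c s)))); [intros s; now destruct (c s)|].
rewrite Ex, Ey in F.
assert (G := derivable_pt_lim_comp_2d (fun a b => f (a, b)) (fun s => Re (c s)) (fun s => Im (c s))
  t _ _ _ _ F (proj1 (is_derive_Reals _ _ _) H1) (proj1 (is_derive_Reals _ _ _) H2)).
apply is_derive_Reals in G.
apply (is_derive_eq _ _ _ _ G).
rewrite <- Ex, <- Ey; simpl; unfold Re, Im; ring.
Qed.

Lemma has_grad_comp_l (G : R -> R) (G' : R -> R) (u : C -> R) (a : C -> C) :
  has_grad u a -> (forall z, unit_disk z -> is_derive G (u z) (G' (u z))) ->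
  has_grad (fun z => G (u z)) (fun z => RtoC (G' (u z)) * a z)%C.
Proof.
intros Hu HG c t d Hc Hd.
eapply is_derive_eq.
- apply (is_derive_comp G (fun s => u (c s))); [apply HG, Hd | apply Hu; eassumption].
- unfold scal; simpl; unfold mult; simpl; unfold Re, Im; ring.
Qed.

Lemma C1_continuous (f : C -> R) : C1_on unit_disk f -> forall z, unit_disk z -> continuous f z.
Proof.
intros Hf [x y] Hd.
assert (F := C1_differentiable f x y Hf Hd).
apply (continuous_ext (fun u : R * R => f (fst u, snd u))); [now intros []|].
apply (filterdiff_continuous (fun u : R * R => f (fst u, snd u))); eexists; exact F.
Qed.

(** Symmetry of second derivatives supplies one of the two Cauchy-Riemann
    equations for the gradient of the flattened function. *)
Lemma mixed_partials (f : C -> R) z : C2_on unit_disk f -> unit_disk z ->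
  dx (dy f) z = dy (dx f) z.
Proof.
intros [F1 [F2 F3]] Hz; destruct z as [x y].
apply (Schwarz (fun a b => f (a, b)) x y).
- apply locally_2d_locally; apply filter_imp with (2 := disk_open _ Hz); intros [a b] Hab; simpl.
  destruct (F1 _ Hab) as [A1 [A2 _]], (F2 _ Hab) as [_ [A3 _]], (F3 _ Hab) as [A4 _].
  repeat split; assumption.
- apply continuity_2d_pt_filterlim.
  apply (continuous_ext (dx (dy f))); [now intros []|].
  exact (proj1 (proj2 (proj2 (F3 _ Hz)))).
- apply continuity_2d_pt_filterlim.
  apply (continuous_ext (dy (dx f))); [now intros []|].
  exact (proj2 (proj2 (proj2 (F2 _ Hz)))).
Qed.

Section Harmonic.
Variables (Rm : R -> R) (f : C -> R).
Hypothesis HR : smooth_metric Rm.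
Hypothesis HK : nonneg_curvature Rm.
Hypothesis Hf : R_harmonic Rm f.

Let f_in z : unit_disk z -> -1 < f z < 1.
Proof. apply Hf. Qed.

Definition flat_grad (z : C) : C := (RtoC (Rm (f z)) * (dx f z, (- dy f z)%R))%C.

Definition flat_grad' (z : C) : C :=
  (Derive Rm (f z) * dx f z * dx f z + Rm (f z) * dx (dx f) z,
   - (Derive Rm (f z) * dx f z * dy f z + Rm (f z) * dx (dy f) z)).

Lemma flattening_has_grad : has_grad (fun z => flattening Rm (f z)) flat_grad.
Proof.
apply (has_grad_comp_l (flattening Rm) Rm f).
- apply C1_has_grad, Hf.
- intros z Hz; apply flattening_deriv; auto.
Qed.

(** Writing [P - i Q] for [flat_grad], the equation [P_y = Q_x] is the symmetry
    of second derivatives, and [P_x = - Q_y] is the [R]-harmonic equation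
    multiplied by [Rm (f z)]. *)
Lemma flat_grad_holo : holo flat_grad flat_grad'.
Proof.
destruct Hf as [_ [[F1 [F2 F3]] HL]].
split.
- intros c t d Hc Hd.
  assert (D := C1_has_grad f F1 c t d Hc Hd).
  assert (D1 := C1_has_grad _ F2 c t d Hc Hd).
  assert (D2 := C1_has_grad _ F3 c t d Hc Hd).
  assert (E : is_derive (fun s => Rm (f (c s))) t
     (Derive Rm (f (c t)) * (dx f (c t) * Re d + dy f (c t) * Im d))).
  { eapply is_derive_eq; [apply (is_derive_comp Rm (fun s => f (c s)) t _ _ (metric_deriv Rm HR _ (f_in _ Hd)) D)|].
    unfold scal; simpl; unfold mult; simpl; unfold Re, Im; ring. }
  assert (M := mixed_partials f _ (conj F1 (conj F2 F3)) Hd).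
  assert (L := HL _ Hd); unfold laplacian, grad_norm in L.
  rewrite pow2_sqrt in L by nra.
  assert (P := metric_pos Rm HR _ (f_in _ Hd)).
  assert (L' : Rm (f (c t)) * dx (dx f) (c t) + Derive Rm (f (c t)) * dx f (c t) ^ 2
     = - (Rm (f (c t)) * dy (dy f) (c t) + Derive Rm (f (c t)) * dy f (c t) ^ 2)).
  { apply (Rmult_eq_compat_l (Rm (f (c t)))) in L.
    field_simplify in L; [|lra]. lra. }
  split; unfold flat_grad, flat_grad'.
  + apply (is_derive_ext (fun s => Rm (f (c s)) * dx f (c s))).
    { intros s; simpl; unfold Re; simpl; ring. }
    eapply is_derive_eq; [exact (Derive.is_derive_mult _ _ _ _ _ E D1)|].
    rewrite M; simpl; unfold Re, Im; simpl; ring.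
  + apply (is_derive_ext (fun s => Rm (f (c s)) * - dy f (c s))).
    { intros s; simpl; unfold Re; simpl; ring. }
    eapply is_derive_eq; [exact (Derive.is_derive_mult _ _ _ _ _ E (is_derive_opp _ _ _ D2))|].
    transitivity ((Rm (f (c t)) * dx (dx f) (c t) + Derive Rm (f (c t)) * dx f (c t) ^ 2) * Im d
      - (Derive Rm (f (c t)) * dx f (c t) * dy f (c t) + Rm (f (c t)) * dx (dy f) (c t)) * Re d).
    * rewrite L'; unfold opp; simpl; unfold Re, Im; simpl; ring.
    * simpl; unfold Re, Im; simpl; ring.
- intros z Hz.
  assert (Cf := C1_continuous f F1 z Hz).
  assert (Cx := C1_continuous _ F2 z Hz).
  assert (Cy := C1_continuous _ F3 z Hz).
  assert (CR : continuous (fun z => Rm (f z)) z).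
  { apply (continuous_comp f Rm); [exact Cf|]; apply metric_cont; auto. }
  assert (CR' : continuous (fun z => Derive Rm (f z)) z).
  { apply (continuous_comp f (Derive Rm)); [exact Cf|].
    apply (ex_derive_continuous (Derive Rm)), metric_deriv2; auto. }
  split.
  + unfold flat_grad; apply continuous_Cmult; apply continuous_ReIm; simpl.
    * exact CR.
    * apply continuous_const.
    * exact Cx.
    * exact (continuous_Ropp _ _ Cy).
  + apply continuous_ReIm; simpl.
    * apply continuous_Rplus; apply continuous_Rmult.
      -- exact (continuous_Rmult _ _ _ CR' Cx).
      -- exact Cx.
      -- exact CR.
      -- exact (proj1 (proj2 (proj2 (F2 _ Hz)))).
    * apply continuous_Ropp, continuous_Rplus; apply continuous_Rmult.
      -- exact (continuous_Rmult _ _ _ CR' Cx).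
      -- exact Cy.
      -- exact CR.
      -- exact (proj1 (proj2 (proj2 (F3 _ Hz)))).
Qed.

Lemma Cmod_grad z : Cmod (dx f z, - dy f z) = grad_norm f z.
Proof. unfold Cmod, grad_norm; simpl; f_equal; ring. Qed.

(** The Schwarz lemma for [flattening o f] involves the ends of its range only
    through an increasing function of their distances, so the range given by the
    exponential majorant at [t = f z] may be used, separately for each [z]. *)
Theorem R_harmonic_grad_bound z : unit_disk z ->
  grad_norm f z <= 4 / PI * ((1 - f z ^ 2) / (1 - Cmod z ^ 2)).
Proof.
intros Hz.
set (t := f z).
assert (Ht : -1 < t < 1) by (now apply f_in).
set (A := RInt (exp_majorant Rm t) (-1) t).
set (B := RInt (exp_majorant Rm t) t 1).
assert (PA : 0 < A) by (apply majorant_RInt_spos; lra || assumption).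
assert (PB : 0 < B) by (apply majorant_RInt_spos; lra || assumption).
assert (P := metric_pos Rm HR t Ht).
assert (G := grad_bound_interval _ _ _ (flattening Rm t - A) (flattening Rm t + B) z
   flattening_has_grad flat_grad_holo ltac:(lra)
   (fun w Hw => flattening_range Rm HR HK (f w) t (f_in w Hw) Ht) Hz).
cbv beta in G; fold t in G.
unfold flat_grad in G; rewrite Cmod_mult, Cmod_R, Cmod_grad in G; fold t in G.
rewrite Rabs_pos_eq in G by lra.
replace ((flattening Rm t + B - flattening Rm t) * (flattening Rm t - (flattening Rm t - A)) /
       (flattening Rm t + B - (flattening Rm t - A))) with (A * B / (A + B)) in G by (field; lra).
assert (H := majorant_harmonic_mean Rm HR t Ht); cbv zeta in H; fold A B in H.
assert (D := disk_one_minus_sqr_pos z Hz).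
assert (Q : 0 < 4 / PI) by (apply Rdiv_lt_0_compat; [lra | apply PI_RGT_0]).
apply (Rmult_le_reg_l (Rm t * (1 - Cmod z ^ 2))); [nra|].
replace (Rm t * (1 - Cmod z ^ 2) * grad_norm f z) with (Rm t * grad_norm f z * (1 - Cmod z ^ 2)) by ring.
apply Rle_trans with (1 := G).
replace (8 / PI * (A * B / (A + B))) with (4 / PI * (2 * (A * B / (A + B)))) by (field; split; [lra | apply PI_neq0]).
apply Rle_trans with (4 / PI * (Rm t * (1 - t ^ 2))).
- apply Rmult_le_compat_l; lra.
- apply Req_le; field; split; [lra | apply PI_neq0].
Qed.
End Harmonic.

(** * The distance inequality *)

Lemma artanh_deriv x : -1 < x < 1 -> is_derive artanh x (/ (1 - x ^ 2)).
Proof.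
intros Hx; unfold artanh.
assert (0 < (1 + x) / (1 - x)) by (apply Rdiv_lt_0_compat; lra).
auto_derive.
- repeat split; (exact H || lra).
- field; repeat split; nra.
Qed.

Lemma artanh_0 : artanh 0 = 0.
Proof. unfold artanh; replace ((1 + 0) / (1 - 0)) with 1 by field; rewrite ln_1; ring. Qed.

Lemma artanh_sub x y : -1 < x < 1 -> -1 < y < 1 ->
  artanh ((x - y) / (1 - x * y)) = artanh x - artanh y.
Proof.
intros Hx Hy; unfold artanh.
assert (0 < 1 - x * y) by nra.
rewrite <- Rmult_minus_distr_l; f_equal.
rewrite <- ln_div by (apply Rdiv_lt_0_compat; lra).
f_equal; field; repeat split; nra.
Qed.

Lemma hyp_dist_real x y : -1 < x < 1 -> -1 < y < 1 ->
  hyp_dist (RtoC x) (RtoC y) = Rabs (artanh x - artanh y).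
Proof.
assert (W : forall x y, -1 < x < 1 -> -1 < y < 1 -> y <= x ->
  hyp_dist (RtoC x) (RtoC y) = artanh x - artanh y /\ 0 <= artanh x - artanh y).
{ clear x y; intros x y Hx Hy Hxy; assert (P : 0 < 1 - x * y) by nra.
  assert (E : hyp_dist (RtoC x) (RtoC y) = artanh ((x - y) / (1 - x * y))).
  { unfold hyp_dist; f_equal; f_equal.
    - replace (RtoC x - RtoC y)%C with (RtoC (x - y)) by (apply RtoC_minus).
      rewrite Cmod_R; apply Rabs_pos_eq; lra.
    - replace (1 - RtoC x * Cconj (RtoC y))%C with (RtoC (1 - x * y)) by (apply C_eq; simpl; ring).
      rewrite Cmod_R; apply Rabs_pos_eq; lra. }
  rewrite <- (artanh_sub x y Hx Hy); split; [exact E|].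
  set (q := (x - y) / (1 - x * y)).
  assert (0 <= q) by (apply Rdiv_le_0_compat; lra).
  assert (q < 1).
  { apply (Rmult_lt_reg_r (1 - x * y)); [exact P|].
    unfold q, Rdiv; rewrite Rmult_assoc, Rinv_l; nra. }
  unfold artanh; apply Rmult_le_pos; [lra|].
  rewrite <- ln_1; apply ln_le; [lra|].
  apply (Rmult_le_reg_r (1 - q)); [lra|].
  unfold Rdiv; rewrite Rmult_assoc, Rinv_l; lra. }
intros Hx Hy; destruct (Rle_or_lt y x) as [L|L].
- destruct (W x y Hx Hy L) as [E P]; now rewrite Rabs_pos_eq.
- destruct (W y x Hy Hx ltac:(lra)) as [E P].
  rewrite Rabs_minus_sym, Rabs_pos_eq by exact P; rewrite <- E.
  unfold hyp_dist; f_equal; f_equal.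
  + rewrite <- Cmod_opp; f_equal; ring.
  + rewrite <- Cmod_conj; f_equal; apply C_eq; simpl; ring.
Qed.

Lemma mob_inverse z w : unit_disk z -> unit_disk w -> mob z (mob (- z) w) = w.
Proof.
intros Hz Hw.
assert (Hz' : unit_disk (- z)) by (unfold unit_disk; now rewrite Cmod_opp).
assert (D1 := mob_den _ _ Hz' Hw).
assert (D2 := mob_den _ _ Hz (mob_disk _ _ Hz' Hw)).
assert (E : Cconj (- z) = (- Cconj z)%C) by (apply C_eq; simpl; ring).
unfold mob in *; rewrite E in *.
assert (D3 : (1 + - Cconj z * w + Cconj z * (w + - z))%C <> 0%C).
{ intros Q; apply D2.
  replace (1 + Cconj z * ((w + - z) * / (1 + - Cconj z * w)))%C
   with ((1 + - Cconj z * w + Cconj z * (w + - z)) * / (1 + - Cconj z * w))%C by (field; exact D1).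
  rewrite Q; ring. }
field; split; assumption.
Qed.

Lemma hyp_dist_mob z w : unit_disk z -> unit_disk w ->
  hyp_dist z w = artanh (Cmod (mob (- z) w)).
Proof.
intros Hz Hw.
assert (Hz' : unit_disk (- z)) by (unfold unit_disk; now rewrite Cmod_opp).
assert (D1 := mob_den _ _ Hz' Hw).
unfold hyp_dist, mob; f_equal; rewrite Cmod_mult, Cmod_inv by exact D1.
unfold Rdiv; f_equal.
- rewrite <- Cmod_opp; f_equal; ring.
- f_equal; rewrite <- Cmod_conj; f_equal; apply C_eq; simpl; ring.
Qed.

(** The image of the segment [[0, T]] under a disk automorphism [p] is the
    geodesic from [z] to [w], with [artanh T] its hyperbolic length.  As [p] is
    an isometry, the hypothesis bounds the derivative of [artanh (f (p s))] in
    absolute value by [K / (1 - s^2)], the derivative of [K artanh s]. *)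
Theorem distance_of_grad_bound (f : C -> R) (a : C -> C) (K : R) :
  has_grad f a -> (forall z, unit_disk z -> -1 < f z < 1) ->
  (forall z, unit_disk z -> Cmod (a z) * (1 - Cmod z ^ 2) <= K * (1 - f z ^ 2)) ->
  forall z w, unit_disk z -> unit_disk w ->
  hyp_dist (RtoC (f z)) (RtoC (f w)) <= K * hyp_dist z w.
Proof.
intros Hf Hin HK z w Hz Hw.
rewrite hyp_dist_real, hyp_dist_mob by auto.
assert (Hz' : unit_disk (- z)) by (unfold unit_disk; now rewrite Cmod_opp).
set (q := mob (- z) w).
assert (Hq : unit_disk q) by (now apply mob_disk).
(* the rotation o is chosen so that q lies on the image of the positive axis *)
destruct (rotation_to_real (Cconj q)) as [o [Ho Eo]].
rewrite Cmod_conj in Eo; set (T := Cmod q) in *.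
assert (HT : 0 <= T < 1) by (split; [apply Cmod_ge_0 | exact Hq]).
assert (EQ : q = (o * RtoC T)%C).
{ replace (RtoC T) with (Cconj (RtoC T)) by (apply C_eq; simpl; ring).
  rewrite <- Eo.
  assert (O2 : (o * Cconj o)%C = 1%C).
  { apply C_eq; simpl; [|unfold Re, Im; ring].
    pose proof (Cmod_sqr o) as S; rewrite Ho in S; unfold Re, Im in *; lra. }
  replace (o * Cconj (Cconj q * o))%C with (q * (o * Cconj o))%C by (apply C_eq; simpl; unfold Re, Im; ring).
  rewrite O2; ring. }
set (p := fun s : C => mob z (o * s)%C).
assert (HRot : forall s, unit_disk s -> unit_disk (o * s)%C) by (intros; now apply rot_disk).
assert (HP : forall s, unit_disk s -> unit_disk (p s)) by (intros; apply mob_disk; auto).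
assert (Hp := holo_comp _ _ _ _ (holo_mob z Hz) (holo_rot o) HRot).
assert (Hg := has_grad_comp f a _ _ Hf Hp HP).
set (b := fun s : C => (a (p s) * (mob' z (o * s) * o))%C).
assert (DT : forall s : R, Rabs s < 1 -> unit_disk (RtoC s)) by (intros s Hs; unfold unit_disk; now rewrite Cmod_R).
set (F := fun s : R => artanh (f (p (RtoC s)))).
assert (DF : forall s, Rabs s < 1 -> is_derive F s (/ (1 - f (p (RtoC s)) ^ 2) * Re (b (RtoC s)))).
{ intros s Hs; unfold F.
  assert (Cs : curve_deriv RtoC s 1%C).
  { split; simpl; [apply (is_derive_id (K := R_AbsRing)) | apply (is_derive_const (K := R_AbsRing) (V := R_NormedModule))]. }
  eapply is_derive_eq; [apply (is_derive_comp artanh (fun s : R => f (p (RtoC s))))|].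
  - apply artanh_deriv; auto.
  - exact (Hg RtoC s _ Cs (DT s Hs)).
  - unfold scal; simpl; unfold mult; simpl; unfold b, p; simpl; unfold Re, Im; simpl; ring. }
assert (BF : forall s, Rabs s < 1 ->
  Rabs (/ (1 - f (p (RtoC s)) ^ 2) * Re (b (RtoC s))) <= K * / (1 - s ^ 2)).
{ intros s Hs.
  assert (Ds := DT s Hs).
  assert (Dp := HP _ Ds).
  assert (Fp := Hin _ Dp).
  assert (P1 : 0 < 1 - f (p (RtoC s)) ^ 2) by nra.
  assert (P2 := disk_one_minus_sqr_pos _ Dp).
  assert (P3 := disk_one_minus_sqr_pos _ Ds).
  assert (ES : Cmod (RtoC s) ^ 2 = s ^ 2) by (rewrite Cmod_R; apply pow2_abs).
  rewrite Rabs_mult, Rabs_pos_eq by (apply Rlt_le, Rinv_0_lt_compat, P1).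
  apply Rle_trans with (/ (1 - f (p (RtoC s)) ^ 2) * Cmod (b (RtoC s))).
  { apply Rmult_le_compat_l; [apply Rlt_le, Rinv_0_lt_compat, P1|].
    eapply Rle_trans; [apply Rmax_l | apply Rmax_Cmod]. }
  assert (N := mob'_norm z _ Hz (HRot _ Ds)).
  fold (p (RtoC s)) in N; rewrite Cmod_mult, Ho, Rmult_1_l, ES in N.
  unfold b; rewrite !Cmod_mult, Ho, Rmult_1_r.
  assert (G := HK _ Dp); rewrite <- N in G.
  rewrite ES in P3.
  apply (Rmult_le_reg_r ((1 - f (p (RtoC s)) ^ 2) * (1 - s ^ 2))); [now apply Rmult_lt_0_compat|].
  replace (/ (1 - f (p (RtoC s)) ^ 2) * (Cmod (a (p (RtoC s))) * Cmod (mob' z (o * RtoC s)%C)) *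
    ((1 - f (p (RtoC s)) ^ 2) * (1 - s ^ 2))) with
   (Cmod (a (p (RtoC s))) * (Cmod (mob' z (o * RtoC s)%C) * (1 - s ^ 2))) by (field; lra).
  replace (K * / (1 - s ^ 2) * ((1 - f (p (RtoC s)) ^ 2) * (1 - s ^ 2)))
   with (K * (1 - f (p (RtoC s)) ^ 2)) by (field; lra).
  exact G. }
assert (F0 : F 0 = artanh (f z)) by (unfold F, p; now rewrite Cmult_0_r, mob_0).
assert (F1 : F T = artanh (f w)).
{ unfold F, p; rewrite <- EQ; unfold q; now rewrite mob_inverse. }
rewrite <- F0, <- F1.
(* the two signs e give the two halves of the absolute value *)
assert (S : forall e, e = 1 \/ e = -1 -> e * (F T - F 0) <= K * artanh T).
{ intros e He.
  set (dG := fun s => K * / (1 - s ^ 2) - e * (/ (1 - f (p (RtoC s)) ^ 2) * Re (b (RtoC s)))).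
  assert (DG : forall s, 0 <= s <= T -> is_derive (fun s => K * artanh s - e * F s) s (dG s)).
  { intros s Hs; apply (is_derive_minus (fun s => K * artanh s) (fun s => e * F s)).
    - apply is_derive_scal, artanh_deriv; lra.
    - apply is_derive_scal, DF; rewrite Rabs_pos_eq; lra. }
  destruct (MVT_gen (fun s => K * artanh s - e * F s) 0 T dG) as [c [Hc E]].
  - rewrite Rmin_left, Rmax_right by lra; intros; apply DG; lra.
  - rewrite Rmin_left, Rmax_right by lra; intros x Hx.
    apply continuity_pt_filterlim; exact (is_derive_continuous _ _ _ (DG x Hx)).
  - rewrite Rmin_left, Rmax_right in Hc by lra.
    assert (Bc := BF c ltac:(rewrite Rabs_pos_eq; lra)); apply Rabs_le_between in Bc.
    assert (0 <= dG c) by (unfold dG; destruct He; subst e; lra).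
    rewrite artanh_0 in E; nra. }
assert (S1 := S 1 ltac:(auto)); assert (S2 := S (-1) ltac:(auto)).
apply Rabs_le; lra.
Qed.

(** * Sharpness *)

Lemma has_grad_partials (u : C -> R) (a : C -> C) z : has_grad u a -> unit_disk z ->
  is_derive (fun x => u (x, Im z)) (Re z) (Re (a z)) /\
  is_derive (fun y => u (Re z, y)) (Im z) (- Im (a z)).
Proof.
intros Hu Hz; split.
- eapply is_derive_eq.
  + apply (Hu (fun x => (x, Im z)) (Re z) (1, 0)); [split; simpl|now destruct z].
    * apply (is_derive_id (K := R_AbsRing)).
    * apply (is_derive_const (K := R_AbsRing) (V := R_NormedModule)).
  + destruct z; simpl; unfold Re, Im; ring.
- eapply is_derive_eq.
  + apply (Hu (fun y => (Re z, y)) (Im z) (0, 1)); [split; simpl|now destruct z].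
    * apply (is_derive_const (K := R_AbsRing) (V := R_NormedModule)).
    * apply (is_derive_id (K := R_AbsRing)).
  + destruct z; simpl; unfold Re, Im; ring.
Qed.

Lemma has_grad_dx (u : C -> R) (a : C -> C) z : has_grad u a -> unit_disk z -> dx u z = Re (a z).
Proof. intros Hu Hz; apply is_derive_unique; now apply (has_grad_partials u a). Qed.

Lemma has_grad_dy (u : C -> R) (a : C -> C) z : has_grad u a -> unit_disk z -> dy u z = - Im (a z).
Proof. intros Hu Hz; apply is_derive_unique; now apply (has_grad_partials u a). Qed.

Lemma has_grad_C1 (u : C -> R) (a : C -> C) : has_grad u a ->
  (forall z, unit_disk z -> continuous a z) -> C1_on unit_disk u.
Proof.
intros Hu Ha z Hz; destruct (has_grad_partials u a z Hu Hz) as [A B].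
pose proof (continuous_Re a z (Ha z Hz)) as C1; pose proof (continuous_Im a z (Ha z Hz)) as C2.
repeat split; [eexists; exact A | eexists; exact B | |].
- apply (continuous_ext_loc _ (fun w => Re (a w))); [|exact C1].
  apply filter_imp with (2 := disk_open z Hz); intros w Hw; symmetry; now apply has_grad_dx.
- apply (continuous_ext_loc _ (fun w => - Im (a w))); [|exact (continuous_Ropp _ _ C2)].
  apply filter_imp with (2 := disk_open z Hz); intros w Hw; symmetry; now apply has_grad_dy.
Qed.

Lemma has_grad_ext (u v : C -> R) (a : C -> C) :
  (forall z, unit_disk z -> u z = v z) -> has_grad u a -> has_grad v a.
Proof.
intros E Hu c t d Hc Hd.
apply (is_derive_ext_loc (fun s => u (c s))); [|now apply Hu].
assert (Cc : continuous c t).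
{ destruct Hc as [A B]; apply continuous_ReIm.
  - exact (is_derive_continuous _ _ _ A).
  - exact (is_derive_continuous _ _ _ B). }
apply filter_imp with (fun s => unit_disk (c s)); [intros s Hs; now apply E|].
exact (Cc _ (disk_open _ Hd)).
Qed.

(** The converse of the passage from [u] to its holomorphic gradient: the second
    derivatives are [Re h'] and [- Re h']. *)
Lemma harmonic_of_holo (u : C -> R) (h h' : C -> C) : has_grad u h -> holo h h' ->
  C2_on unit_disk u /\ forall z, unit_disk z -> laplacian u z = 0.
Proof.
intros Hu Hh.
assert (Gx : has_grad (dx u) h').
{ apply (has_grad_ext (fun z => Re (h z))); [|now apply holo_Re].
  intros z Hz; symmetry; now apply has_grad_dx. }
assert (Gy : has_grad (dy u) (fun z => Ci * h' z)%C).
{ apply (has_grad_ext (fun z => - Im (h z))).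
  { intros z Hz; symmetry; now apply has_grad_dy. }
  intros c t d Hc Hd; destruct (proj1 Hh c t d Hc Hd) as [_ B].
  apply (is_derive_eq _ _ _ _ (is_derive_opp _ _ _ B)).
  unfold opp; simpl; unfold Re, Im; ring. }
assert (Ch := proj2 Hh).
split.
- split; [|split].
  + apply (has_grad_C1 u h Hu); intros z Hz; exact (proj1 (Ch z Hz)).
  + apply (has_grad_C1 _ _ Gx); intros z Hz; exact (proj2 (Ch z Hz)).
  + apply (has_grad_C1 _ _ Gy); intros z Hz; apply continuous_Cmult; [apply continuous_const | exact (proj2 (Ch z Hz))].
- intros z Hz; unfold laplacian.
  rewrite (has_grad_dx _ _ z Gx Hz), (has_grad_dy _ _ z Gy Hz).
  simpl; unfold Re, Im; ring.
Qed.

Lemma const_metric_smooth : smooth_metric (fun _ => 1).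
Proof. intros u _; split; [lra|]; intros n; apply ex_derive_n_const. Qed.

Lemma const_metric_curvature : nonneg_curvature (fun _ => 1).
Proof.
intros u _; unfold gaussian_curvature.
rewrite (Derive_ext _ (fun _ => 0)).
- rewrite Derive_const; lra.
- intros t; rewrite Derive_const; field.
Qed.

(** This is [2/PI] times the argument of [(1 + z) / (1 - z)], the imaginary part
    of the conformal map of the disk onto the strip of width [2]. *)
Definition extremal (z : C) : R :=
  2 / PI * atan (2 * Im z / (1 - Re z ^ 2 - Im z ^ 2)).

(** This is [- i] times the derivative [4 / (PI (1 - z^2))] of that conformal map. *)
Definition extremal_grad (z : C) : C :=
  ((0, (- (4 / PI))%R) * / (1 + RtoC (-1) * (z * z)))%C.

Lemma extremal_den z : unit_disk z -> (1 + RtoC (-1) * (z * z))%C <> 0%C.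
Proof.
intros Hz E; apply unit_disk_sqr in Hz.
apply (f_equal Re) in E; simpl in E; unfold Re, Im in *; nra.
Qed.

Lemma extremal_has_grad : has_grad extremal extremal_grad.
Proof.
intros c t d [A B] Hd.
assert (ND := extremal_den _ Hd).
assert (S := proj1 (unit_disk_sqr _) Hd).
unfold extremal, extremal_grad.
set (x := Re (c t)) in *; set (y := Im (c t)) in *.
assert (P : 1 - x ^ 2 - y ^ 2 <> 0) by lra.
assert (DD : is_derive (fun s => 1 - Re (c s) ^ 2 - Im (c s) ^ 2) t (- 2 * x * Re d - 2 * y * Im d)).
{ eapply is_derive_eq.
  - apply (is_derive_minus (fun s => 1 - Re (c s) ^ 2) (fun s => Im (c s) ^ 2)).
    + apply (is_derive_minus (fun _ => 1) (fun s => Re (c s) ^ 2)); [apply is_derive_const|].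
      apply is_derive_pow; exact A.
    + apply is_derive_pow; exact B.
  - unfold minus, plus, opp, zero; simpl; fold x y; ring. }
eapply is_derive_eq.
- apply is_derive_scal, (is_derive_comp atan (fun s => 2 * Im (c s) / (1 - Re (c s) ^ 2 - Im (c s) ^ 2))).
  + apply is_derive_atan.
  + apply is_derive_div; [apply is_derive_scal, B | exact DD | exact P].
- clear - P S; unfold x, y in *; clear x y.
  destruct (c t) as [x y], d as [d1 d2].
  unfold scal; simpl in *; unfold mult, Re, Im, Rsqr in *; simpl in *.
  field.
  assert (Q : 0 < 1 + -1 * (x * x - y * y)) by nra.
  repeat split; [|apply PI_neq0|lra].
  apply Rgt_not_eq, Rplus_lt_le_0_compat; nra.
Qed.

Lemma extremal_holo : exists k, holo extremal_grad k.
Proof.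
eexists; unfold extremal_grad.
exact (holo_mult _ _ _ _ (holo_const _)
  (holo_inv _ _ (holo_plus _ _ _ _ (holo_const 1%C)
     (holo_mult _ _ _ _ (holo_const _) (holo_mult _ _ _ _ holo_id holo_id))) extremal_den)).
Qed.

Lemma extremal_range z : -1 < extremal z < 1.
Proof.
unfold extremal; set (q := 2 * Im z / _).
pose proof (atan_bound q) as B; pose proof PI_RGT_0 as P.
assert (E : 2 / PI * (PI / 2) = 1) by (field; lra).
assert (0 < 2 / PI) by (apply Rdiv_lt_0_compat; lra).
split; nra.
Qed.

Lemma extremal_R_harmonic : R_harmonic (fun _ => 1) extremal.
Proof.
destruct extremal_holo as [k Hk].
destruct (harmonic_of_holo _ _ _ extremal_has_grad Hk) as [H1 H2].
split; [intros; apply extremal_range|]; split; [exact H1|].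
intros z Hz; rewrite H2, Derive_const by exact Hz.
unfold Rdiv; ring.
Qed.

Lemma strip_map_0 : extremal 0%C = 0.
Proof.
unfold extremal; simpl; unfold Rdiv; rewrite Rmult_0_r, Rmult_0_l, atan_0; ring.
Qed.

Lemma strip_grad_0 : extremal_grad 0%C = (0, - (4 / PI)).
Proof.
unfold extremal_grad; replace (1 + RtoC (-1) * (0 * 0))%C with (RtoC 1) by ring.
rewrite <- (Cmult_1_r (0, - (4 / PI))) at 2; f_equal.
apply C_eq; simpl; field.
Qed.

Lemma extremal_grad_sharp (c : R) :
  (forall z, unit_disk z -> grad_norm extremal z
      <= c * ((1 - extremal z ^ 2) / (1 - Cmod z ^ 2))) -> 4 / PI <= c.
Proof.
intros H; specialize (H _ disk0).
assert (P : 0 < 4 / PI) by (apply Rdiv_lt_0_compat; [lra | apply PI_RGT_0]).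
unfold grad_norm in H.
rewrite (has_grad_dx _ _ _ extremal_has_grad disk0), (has_grad_dy _ _ _ extremal_has_grad disk0) in H.
rewrite strip_grad_0, strip_map_0, Cmod_0 in H; unfold Re, Im, fst, snd in H.
replace (0 ^ 2 + (- - (4 / PI)) ^ 2) with (4 / PI * (4 / PI)) in H by ring.
rewrite sqrt_square in H by lra.
replace ((1 - 0 ^ 2) / (1 - 0 ^ 2)) with 1 in H by field; lra.
Qed.

Lemma pos_deriv_increase (f : R -> R) (l : R) : is_derive f 0 l -> 0 < l ->
  exists t, 0 < t < 1 /\ f 0 < f t.
Proof.
intros D Hl; apply is_derive_Reals in D.
destruct (D l Hl) as [de Hd].
set (t := Rmin (/ 2) (de / 2)).
assert (Pd := cond_pos de).
assert (Ht : 0 < t) by (apply Rmin_pos; lra).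
assert (Ht1 : t <= / 2) by apply Rmin_l.
assert (Ht2 : t <= de / 2) by apply Rmin_r.
exists t; split; [lra|].
specialize (Hd t ltac:(lra) ltac:(rewrite Rabs_pos_eq; lra)).
apply Rabs_def2 in Hd; rewrite Rplus_0_l in Hd.
assert (0 < (f t - f 0) / t) by lra.
assert (0 < (f t - f 0) / t * t) by now apply Rmult_lt_0_compat.
unfold Rdiv in *; rewrite Rmult_assoc, Rinv_l in * by lra; lra.
Qed.

(** Along the imaginary axis both distances to the origin vanish at [t = 0], so
    the ratio of their derivatives there, which is [4/PI], is a lower bound for
    [c]. *)
Lemma extremal_distance_sharp (c : R) :
  (forall z w, unit_disk z -> unit_disk w ->
     hyp_dist (RtoC (extremal z)) (RtoC (extremal w)) <= c * hyp_dist z w) -> 4 / PI <= c.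
Proof.
intros H; destruct (Rle_or_lt (4 / PI) c) as [|L]; [assumption|exfalso].
assert (D : is_derive (fun t => artanh (extremal (0, t)) - c * artanh t) 0 (4 / PI - c)).
{ destruct (has_grad_partials _ _ _ extremal_has_grad disk0) as [_ B].
  rewrite strip_grad_0 in B; unfold Re, Im in B; simpl in B.
  eapply is_derive_eq.
  - apply (is_derive_minus (fun t => artanh (extremal (0, t))) (fun t => c * artanh t)).
    + apply (is_derive_comp artanh (fun t => extremal (0, t))); [|exact B].
      apply artanh_deriv, extremal_range.
    + apply is_derive_scal, artanh_deriv; lra.
  - change (extremal (0, 0)) with (extremal 0%C); rewrite strip_map_0.
    unfold minus, plus, opp, scal; simpl; unfold mult; simpl; field; apply PI_neq0. }
destruct (pos_deriv_increase _ _ D ltac:(lra)) as [t [Ht I]].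
change (extremal (0, 0)) with (extremal 0%C) in I.
rewrite strip_map_0, artanh_0 in I.
assert (Dt : unit_disk (0, t)) by (apply unit_disk_sqr; simpl; nra).
specialize (H (0, t) 0%C Dt disk0).
rewrite strip_map_0, hyp_dist_real, artanh_0 in H by (try apply extremal_range; lra).
assert (E : hyp_dist (0, t) 0%C = artanh t).
{ unfold hyp_dist; f_equal.
  replace (Cmod ((0, t) - 0)%C) with t.
  - replace (1 - (0, t) * Cconj 0)%C with (RtoC 1) by (apply C_eq; simpl; ring).
    rewrite Cmod_1; field.
  - replace ((0, t) - 0)%C with (Ci * RtoC t)%C by (apply C_eq; simpl; ring).
    rewrite Cmod_mult, Cmod_Ci, Cmod_R, Rabs_pos_eq; lra. }
rewrite E in H.
change (0 - c * 0 < artanh (extremal (0, t)) - c * artanh t) in I.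
pose proof (Rle_abs (artanh (extremal (0, t)) - 0)); lra.
Qed.

Theorem theorem2p1 :
  (forall (Rm : R -> R) (f : C -> R),
     smooth_metric Rm -> nonneg_curvature Rm -> R_harmonic Rm f ->
     forall z w : C, unit_disk z -> unit_disk w ->
       grad_norm f z <= 4 / PI * ((1 - f z ^ 2) / (1 - Cmod z ^ 2)) /\
       hyp_dist (RtoC (f z)) (RtoC (f w)) <= 4 / PI * hyp_dist z w)
  /\
  (forall c : R, c < 4 / PI ->
     ~ (forall (Rm : R -> R) (f : C -> R),
          smooth_metric Rm -> nonneg_curvature Rm -> R_harmonic Rm f ->
          forall z : C, unit_disk z ->
            grad_norm f z <= c * ((1 - f z ^ 2) / (1 - Cmod z ^ 2))))
  /\
  (forall c : R, c < 4 / PI ->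
     ~ (forall (Rm : R -> R) (f : C -> R),
          smooth_metric Rm -> nonneg_curvature Rm -> R_harmonic Rm f ->
          forall z w : C, unit_disk z -> unit_disk w ->
            hyp_dist (RtoC (f z)) (RtoC (f w)) <= c * hyp_dist z w)).
Proof.
split; [|split].
- intros Rm f HR HK Hf z w Hz Hw.
  assert (G := R_harmonic_grad_bound Rm f HR HK Hf).
  split; [now apply G|].
  destruct Hf as [Hin [[F1 _] _]].
  apply (distance_of_grad_bound f _ (4 / PI) (C1_has_grad f F1) Hin); [|exact Hz|exact Hw].
  intros v Hv; cbv beta; rewrite Cmod_grad.
  assert (D := disk_one_minus_sqr_pos v Hv).
  apply Rle_trans with (4 / PI * ((1 - f v ^ 2) / (1 - Cmod v ^ 2)) * (1 - Cmod v ^ 2)).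
  + apply Rmult_le_compat_r; [lra | now apply G].
  + apply Req_le; field; split; [apply PI_neq0 | lra].
- intros c Hc H.
  enough (4 / PI <= c) by lra.
  apply extremal_grad_sharp, (H (fun _ => 1) extremal const_metric_smooth const_metric_curvature extremal_R_harmonic).
- intros c Hc H.
  enough (4 / PI <= c) by lra.
  apply extremal_distance_sharp, (H (fun _ => 1) extremal const_metric_smooth const_metric_curvature extremal_R_harmonic).
Qed.
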